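(* Let $0\le q\le p$, let $\kappa_1,\dots,\kappa_q$ be real constants, let $\nu_{q+1},\dots,\nu_p\in(0,1)$, and for $\alpha=(\alpha_1,\dots,\alpha_q)\in\mathbb{N}^q$ and $\beta=(\beta_{q+1},\dots,\beta_p)\in\mathbb{N}^{p-q}$ set $\nu_\beta:=\beta_{q+1}\nu_{q+1}+\dots+\beta_p\nu_p$ and $$\mathscr T_{\alpha,\beta}(\zeta):=\prod_{k=1}^q(\log\zeta+\kappa_k)^{-\alpha_k}\prod_{k=q+1}^p\zeta^{-\beta_k\nu_k},$$ with the branch of the logarithm fixed on $\mathbb{C}\setminus\mathbb{R}^-$. Let $$\mathscr L^{-1}(\mathscr T_{\alpha,\beta})(t)=\frac{1}{2\pi i}\int_{\delta+i\mathbb{R}}e^{t\zeta}\,\mathscr T_{\alpha,\beta}(\zeta)\,d\zeta$$ for a fixed $\delta>0$. Then, up to additive components which are smooth functions in $C^\infty[0,\infty)$, there are constants $E_{\beta k}$ such that $$\mathscr L^{-1}(\mathscr T_{\alpha,\beta})(t)\sim\sum_{k=0}^\infty E_{\beta k}\,t^{-1+\nu_\beta}\log^{-|\alpha|-k}(t),\qquad t\to0,$$ where $|\alpha|=\alpha_1+\dots+\alpha_q$. *)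

(* Defs.v *)
From Stdlib Require Import Reals.
From Coquelicot Require Import Coquelicot.
Open Scope R_scope.

(* principal argument, with values in (-PI, PI]  (branch cut along R^-) *)
Definition Carg (z : C) : R :=
  let x := fst z in let y := snd z in
  if Rlt_dec 0 x then atan (y / x)
  else if Rlt_dec x 0 then
    (if Rle_dec 0 y then atan (y / x) + PI else atan (y / x) - PI)
  else if Rlt_dec 0 y then PI / 2
  else if Rlt_dec y 0 then - (PI / 2) else 0.

Definition Clog (z : C) : C := (ln (Cmod z), Carg z).

Definition Cexp (z : C) : C := (exp (fst z) * cos (snd z), exp (fst z) * sin (snd z)).

Fixpoint Cpown (z : C) (n : nat) : C :=
  match n with O => RtoC 1 | S n => Cmult z (Cpown z n) end.

Fixpoint Cprod_from (f : nat -> C) (a n : nat) : C :=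
  match n with O => RtoC 1 | S n => Cmult (f a) (Cprod_from f (S a) n) end.

Fixpoint Csum_lt (f : nat -> C) (N : nat) : C :=
  match N with O => RtoC 0 | S N => Cplus (Csum_lt f N) (f N) end.

Fixpoint nsum_from (f : nat -> nat) (a n : nat) : nat :=
  match n with O => O | S n => (f a + nsum_from f (S a) n)%nat end.

Fixpoint rsum_from (f : nat -> R) (a n : nat) : R :=
  match n with O => 0 | S n => f a + rsum_from f (S a) n end.

Definition T_ab (p q : nat) (kappa nu : nat -> R) (alpha beta : nat -> nat) (z : C) : C :=
  Cmult
    (Cprod_from (fun k => Cinv (Cpown (Cplus (Clog z) (RtoC (kappa k))) (alpha k))) 1 q)
    (Cprod_from (fun k => Cexp (Cmult (RtoC (- (INR (beta k) * nu k))) (Clog z))) (S q) (p - q)).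

Definition abs_alpha (q : nat) (alpha : nat -> nat) : nat := nsum_from alpha 1 q.

Definition nu_beta (p q : nat) (nu : nat -> R) (beta : nat -> nat) : R :=
  rsum_from (fun k => INR (beta k) * nu k) (S q) (p - q).

(* With zeta = delta + i y, d zeta = i dy, so
   (1/(2 pi i)) int_{delta+iR} e^{t zeta} F(zeta) d zeta
     = (1/(2 pi)) int_R e^{t (delta + i y)} F(delta + i y) dy,
   understood as the limit of the integrals over [-R, R] as R -> +oo. *)
Definition bromwich_integrand (F : C -> C) (delta t y : R) : C :=
  Cmult (RtoC (/ (2 * PI))) (Cmult (Cexp (Cmult (RtoC t) (delta, y))) (F (delta, y))).

Definition is_inv_laplace (F : C -> C) (delta t : R) (v : C) : Prop :=
  is_lim (fun L => RInt (fun y => fst (bromwich_integrand F delta t y)) (- L) L) p_infty (fst v) /\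
  is_lim (fun L => RInt (fun y => snd (bromwich_integrand F delta t y)) (- L) L) p_infty (snd v).

(* g is in C^oo[0,oo): it agrees on [0,oo) with a C^oo function on R
   (equivalent, by Seeley's extension theorem, to one-sided smoothness at 0). *)
Definition smooth_R (G : R -> R) : Prop := forall (n : nat) (x : R), ex_derive (Derive_n G n) x.

Definition smooth_on_closed_halfline (g : R -> C) : Prop :=
  exists Gre Gim : R -> R, smooth_R Gre /\ smooth_R Gim /\
    forall t, 0 <= t -> g t = (Gre t, Gim t).

Definition asym_term (nb : R) (a k : nat) (t : R) : R :=
  Rpower t (-1 + nb) * (/ ln t) ^ (a + k).

Definition has_log_asymptotics (h : R -> C) (E : nat -> C) (nb : R) (a : nat) : Prop :=
  forall N : nat, exists M eps : R, 0 < eps /\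
    forall t, 0 < t < eps ->
      Cmod (Cminus (h t) (Csum_lt (fun k => Cmult (E k) (RtoC (asym_term nb a k t))) N))
        <= M * Rabs (asym_term nb a N t).

(* Main.v *)
Require Import Defs.
From Stdlib Require Import Reals Lra Lia.
From Coquelicot Require Import Coquelicot.
Open Scope R_scope.

(* By Cauchy's theorem the line Re z = delta may be moved to Re z = 1 / t, up to the integral over
   a fixed closed rectangle around the poles; that integral is entire in t, hence smooth. On
   Re z = 1 / t put z = s / t, so that log z = log s - log t. With eps = - 1 / log t every factor
   becomes (log z + kappa)^-1 = eps (1 + eps (log s + kappa))^-1, and t^(-1 + nu) eps^|alpha|
   splits off. Three integrations by parts make the remaining integral of
   e^s s^-nu prod_k (1 + eps (log s + kappa_k))^-alpha_k over Re s = 1 absolutely convergent,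
   uniformly in small eps, since derivatives in s gain powers of 1 / s and cost only powers of
   log s. Expanding the integrand in powers of eps to any finite order keeps it in the same class
   of functions, and the integrals of the Taylor coefficients are the constants sought. *)

(** * Complex elementary functions on the right half-plane *)

(** The obstacle is conditional convergence: if nu_beta = 0 the transform decays only like a power
    of 1 / log, without any integrable bound. This decay without a rate is still enough for the
    horizontal sides and for the boundary terms of the first integration by parts. A symbol in log s
    costs at most one power of |s| on Re s = 1, so three integrations, starting from an exponent
    that may be 0, leave |s|^-2 = 1 / (1 + y^2), whose primitive is the arctangent. The poles exp (-
    kappa_k) lie on the positive real axis, so heights at least 1 avoid them, and so does everything
    to the right of a fixed abscissa. Hence the corners of the rectangle can be chosen independently
    of t although the line Re z = 1 / t moves. All integrands live in one syntax, [expr].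
    Regularity, differentiation, bounds and division by eps are recursions on it, so closure of the
    class under [D] and [rest] holds by construction. The expansion in eps is an exact algebraic
    identity with a remainder of the same kind; no Taylor theorem and no limit in eps is
    involved. *)

Lemma C_ext (z w : C) : fst z = fst w -> snd z = snd w -> z = w.
Proof. destruct z, w; simpl; intros; subst; reflexivity. Qed.

Lemma fst_le_Cmod (z : C) : Rabs (fst z) <= Cmod z.
Proof. exact (re_le_Cmod z). Qed.

Lemma snd_le_Cmod (z : C) : Rabs (snd z) <= Cmod z.
Proof. eapply Rle_trans; [apply Rmax_r | apply (Rmax_Cmod z)]. Qed.

Lemma Cmod_le_sum (z : C) : Cmod z <= Rabs (fst z) + Rabs (snd z).
Proof.
  replace z with (RtoC (fst z) + Ci * RtoC (snd z))%C at 1 by (apply C_ext; simpl; ring).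
  eapply Rle_trans; [apply Cmod_triangle|].
  rewrite Cmod_mult, Cmod_Ci, !Cmod_R; lra.
Qed.

Lemma Cexp_plus (z w : C) : Cexp (z + w)%C = (Cexp z * Cexp w)%C.
Proof.
  apply C_ext; unfold Cexp; simpl;
    rewrite exp_plus, ?cos_plus, ?sin_plus; ring.
Qed.

Lemma Cmod_Cexp (z : C) : Cmod (Cexp z) = exp (fst z).
Proof.
  unfold Cmod, Cexp; simpl fst; simpl snd.
  replace (_ + _) with ((exp (fst z))² * ((sin (snd z))² + (cos (snd z))²))
    by (unfold Rsqr; ring).
  rewrite sin2_cos2, Rmult_1_r; apply sqrt_Rsqr; left; apply exp_pos.
Qed.

Lemma Cexp_0 : Cexp 0%C = 1%C.
Proof. apply C_ext; unfold Cexp; simpl; rewrite exp_0, ?cos_0, ?sin_0; ring. Qed.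

Lemma Cexp_opp (z : C) : (Cexp z * Cexp (- z))%C = 1%C.
Proof. rewrite <- Cexp_plus, Cplus_opp_r; apply Cexp_0. Qed.

(** Every contour stays in Re z > 0, where the argument is a single arctangent; derivatives,
    continuity and bounds are all read off this form. *)
Lemma Clog_right (z : C) :
  0 < fst z -> Clog z = (ln (Cmod z), atan (snd z / fst z)).
Proof.
  intros H; unfold Clog, Carg; destruct (Rlt_dec 0 (fst z)); [reflexivity | contradiction].
Qed.

Lemma Cmod_right_pos (z : C) : 0 < fst z -> 0 < Cmod z.
Proof.
  intros H; apply Rlt_le_trans with (1 := H), Rle_trans with (2 := re_le_Cmod z).
  apply RRle_abs.
Qed.

Lemma Cexp_Clog (z : C) : 0 < fst z -> Cexp (Clog z) = z.
Proof.
  intros H; rewrite Clog_right by exact H.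
  assert (Hm := Cmod_right_pos z H).
  assert (Hs : Cmod z = fst z * sqrt (1 + (snd z / fst z)²)).
  { rewrite <- (sqrt_Rsqr (fst z)) at 1 by lra.
    rewrite <- sqrt_mult_alt by apply Rle_0_sqr.
    unfold Cmod; f_equal; unfold Rsqr; field; lra. }
  assert (0 < sqrt (1 + (snd z / fst z)²)).
  { apply sqrt_lt_R0; generalize (Rle_0_sqr (snd z / fst z)); lra. }
  apply C_ext; unfold Cexp; simpl fst; simpl snd; rewrite exp_ln by exact Hm;
    rewrite ?cos_atan, ?sin_atan, Hs; field; lra.
Qed.

Lemma Clog_scale (c : R) (z : C) :
  0 < c -> 0 < fst z -> Clog (RtoC c * z)%C = (RtoC (ln c) + Clog z)%C.
Proof.
  intros Hc Hz.
  assert (Hm := Cmod_right_pos z Hz).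
  rewrite !Clog_right by (try exact Hz; simpl; nra).
  rewrite Cmod_mult, Cmod_R, (Rabs_right c) by lra.
  apply C_ext; simpl.
  - apply ln_mult; assumption.
  - rewrite Rplus_0_l; f_equal; field; lra.
Qed.

(** The principal power z^(-v). The exponent carries the sign so that [v] measures decay and grows
    by one under differentiation. *)
Definition Cpow_neg (v : R) (z : C) : C := Cexp (RtoC (- v) * Clog z)%C.

Lemma Cpow_neg_plus (u v : R) (z : C) :
  Cpow_neg (u + v) z = (Cpow_neg u z * Cpow_neg v z)%C.
Proof.
  unfold Cpow_neg; rewrite <- Cexp_plus; f_equal.
  rewrite !RtoC_opp, RtoC_plus; ring.
Qed.

Lemma Cpow_neg_1 (z : C) : 0 < fst z -> Cpow_neg 1 z = (/ z)%C.
Proof.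
  intros H.
  assert (E : (z * Cpow_neg 1 z)%C = 1%C).
  { rewrite <- (Cexp_Clog z) at 1 by exact H; unfold Cpow_neg.
    rewrite <- (Cexp_opp (Clog z)); do 2 f_equal.
    rewrite RtoC_opp; ring. }
  assert (z <> 0%C) by (intros ->; simpl in H; lra).
  replace (Cpow_neg 1 z) with (/ z * (z * Cpow_neg 1 z))%C by (field; assumption).
  rewrite E; ring.
Qed.

Lemma Cmod_Cpow_neg (v : R) (z : C) :
  0 < fst z -> Cmod (Cpow_neg v z) = Rpower (Cmod z) (- v).
Proof.
  intros H; unfold Cpow_neg; rewrite Cmod_Cexp, Clog_right by exact H.
  unfold Rpower; f_equal; simpl; ring.
Qed.

(** * Componentwise calculus of complex-valued functions *)

Definition derC (u : R -> C) (x : R) (l : C) : Prop :=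
  is_derive (fun s => fst (u s)) x (fst l) /\
  is_derive (fun s => snd (u s)) x (snd l).

(** The domain is arbitrary because continuity is needed both along curves and jointly in the plane,
    the latter for differentiation under the integral. *)
Definition contC {U : UniformSpace} (u : U -> C) (x : U) : Prop :=
  continuous (fun s => fst (u s)) x /\ continuous (fun s => snd (u s)) x.

Lemma derC_const (c : C) (x : R) : derC (fun _ => c) x 0%C.
Proof. split; apply (is_derive_const (V := R_NormedModule)). Qed.

Lemma derC_plus u v x l m :
  derC u x l -> derC v x m -> derC (fun s => (u s + v s)%C) x (l + m)%C.
Proof. intros [H1 H2] [H3 H4]; split; apply (is_derive_plus (V := R_NormedModule)); assumption. Qed.

Lemma derC_mult u v x l m :
  derC u x l -> derC v x m ->
  derC (fun s => (u s * v s)%C) x (l * v x + u x * m)%C.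
Proof.
  intros [H1 H2] [H3 H4]; split; simpl.
  - replace (_ + _) with
      ((fst l * fst (v x) + fst (u x) * fst m) -
       (snd l * snd (v x) + snd (u x) * snd m)) by ring.
    apply (is_derive_minus (V := R_NormedModule));
      apply (is_derive_mult (K := R_AbsRing)); try assumption; apply Rmult_comm.
  - replace (_ + _) with
      ((fst l * snd (v x) + fst (u x) * snd m) +
       (snd l * fst (v x) + snd (u x) * fst m)) by ring.
    apply (is_derive_plus (V := R_NormedModule));
      apply (is_derive_mult (K := R_AbsRing)); try assumption; apply Rmult_comm.
Qed.

Lemma C_norm2_neq_0 (z : C) : z <> 0%C -> fst z ^ 2 + snd z ^ 2 <> 0.
Proof.
  intros H E; apply H; apply C_ext; simpl; nra.
Qed.

Lemma derC_inv u x l :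
  derC u x l -> u x <> 0%C ->
  derC (fun s => (/ u s)%C) x (- l / (u x * u x))%C.
Proof.
  intros Hu H0; apply C_norm2_neq_0 in H0; revert Hu H0.
  (* With the components abstracted to plain real functions, [auto_derive] can treat them as
     unknowns. *)
  cut (forall a b : R -> R, derC (fun s => (a s, b s)) x l -> a x ^ 2 + b x ^ 2 <> 0 ->
    derC (fun s => (/ (a s, b s))%C) x (- l / ((a x, b x) * (a x, b x)))%C).
  { intros H; exact (H (fun s => fst (u s)) (fun s => snd (u s))). }
  intros a b [H1 H2] Hn; simpl in H1, H2.
  assert (Hn' : a x * a x + b x * b x <> 0) by (simpl in Hn; nra).
  split; simpl; auto_derive; repeat split; try (eexists; eassumption); try exact Hn;
    rewrite (is_derive_unique _ _ _ H1), (is_derive_unique _ _ _ H2);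
    field; repeat split; try exact Hn'; try exact Hn;
    replace (_ + _) with ((a x * a x + b x * b x) ^ 2) by ring;
    apply pow_nonzero; exact Hn'.
Qed.

Lemma derC_Cexp u x l :
  derC u x l -> derC (fun s => Cexp (u s)) x (l * Cexp (u x))%C.
Proof.
  cut (forall a b : R -> R, derC (fun s => (a s, b s)) x l ->
    derC (fun s => Cexp (a s, b s)) x (l * Cexp (a x, b x))%C).
  { intros H; exact (H (fun s => fst (u s)) (fun s => snd (u s))). }
  intros a b [H1 H2]; simpl in H1, H2.
  split; unfold Cexp; simpl; auto_derive; repeat split; try (eexists; eassumption);
    rewrite (is_derive_unique _ _ _ H1), (is_derive_unique _ _ _ H2); ring.
Qed.

Lemma derC_continuous u x l : derC u x l -> contC u x.
Proof.
  intros [H1 H2]; split; apply (ex_derive_continuous (V := R_NormedModule)); eexists; eassumption.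
Qed.

Lemma continuous_pos_locally {U : UniformSpace} (f : U -> R) (x : U) :
  continuous f x -> 0 < f x -> locally x (fun s => 0 < f s).
Proof.
  intros Hc Hp; apply (Hc (fun y => 0 < y)).
  apply (open_gt 0); exact Hp.
Qed.

Lemma derC_Clog u x l :
  derC u x l -> 0 < fst (u x) ->
  derC (fun s => Clog (u s)) x (l / u x)%C.
Proof.
  intros Hu Hp; destruct (derC_continuous _ _ _ Hu) as [Hc _].
  (* [Clog] is defined by cases, but near [x] the point stays in the right half-plane, and the
     derivative depends only on values near [x]. *)
  assert (L := continuous_pos_locally _ _ Hc Hp).
  apply (filter_imp _ (fun s => (ln (Cmod (u s)), atan (snd (u s) / fst (u s))) = Clog (u s)))
    in L; [|intros s Hs; rewrite Clog_right by exact Hs; reflexivity].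
  cut (derC (fun s => (ln (Cmod (u s)), atan (snd (u s) / fst (u s)))) x (l / u x)%C).
  { intros [H1 H2]; split;
      [apply is_derive_ext_loc with (2 := H1) | apply is_derive_ext_loc with (2 := H2)];
      revert L; apply filter_imp; intros s ->; reflexivity. }
  clear L Hc; revert Hu Hp.
  cut (forall a b : R -> R, derC (fun s => (a s, b s)) x l -> 0 < a x ->
    derC (fun s => (ln (Cmod (a s, b s)), atan (b s / a s))) x (l / (a x, b x))%C).
  { intros H; exact (H (fun s => fst (u s)) (fun s => snd (u s))). }
  intros a b [H1 H2] Hp; simpl in H1, H2.
  set (Q := a x * (a x * 1) + b x * (b x * 1)).
  assert (Hq : 0 < Q) by (unfold Q; nra).
  split; unfold Cmod; simpl;
    auto_derive; repeat split; try (eexists; eassumption); try exact Hq; try lra;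
    try (apply sqrt_lt_R0, Hq);
    rewrite (is_derive_unique _ _ _ H1), (is_derive_unique _ _ _ H2).
  - fold Q; rewrite Rmult_assoc.
    replace (/ (2 * sqrt Q) * / sqrt Q) with (/ (2 * Q)).
    2: { rewrite <- (sqrt_sqrt Q) at 1 by lra. field. apply Rgt_not_eq, sqrt_lt_R0, Hq. }
    unfold Q in *; field; lra.
  - unfold Q in *; field; repeat split; nra.
Qed.

Section ContC.
Context {U : UniformSpace}.
Implicit Types (u v : U -> C) (x : U).

Lemma contC_const (c : C) x : contC (fun _ => c) x.
Proof. split; apply continuous_const. Qed.

Lemma contC_plus u v x : contC u x -> contC v x -> contC (fun s => (u s + v s)%C) x.
Proof. intros [? ?] [? ?]; split; apply (continuous_plus (V := R_NormedModule)); assumption. Qed.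

Lemma continuous_Rmult (f g : U -> R) x :
  continuous f x -> continuous g x -> continuous (fun s => f s * g s) x.
Proof. intros; apply (continuous_mult (K := R_AbsRing)); assumption. Qed.

Lemma contC_mult u v x : contC u x -> contC v x -> contC (fun s => (u s * v s)%C) x.
Proof.
  intros [? ?] [? ?]; split; simpl.
  - apply (continuous_minus (V := R_NormedModule)); apply continuous_Rmult; assumption.
  - apply (continuous_plus (V := R_NormedModule)); apply continuous_Rmult; assumption.
Qed.

Lemma continuous_norm2 u x : contC u x ->
  continuous (fun s => fst (u s) ^ 2 + snd (u s) ^ 2) x.
Proof.
  intros [H1 H2].
  assert (G : forall f : U -> R, continuous f x -> continuous (fun s => f s ^ 2) x).
  { intros f Hf; apply continuous_Rmult; [exact Hf|].
    apply continuous_Rmult; [exact Hf|apply continuous_const]. }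
  exact (continuous_plus (V := R_NormedModule) _ _ x (G _ H1) (G _ H2)).
Qed.

Lemma contC_inv u x : contC u x -> u x <> 0%C -> contC (fun s => (/ u s)%C) x.
Proof.
  intros Hu H0; assert (Hn := C_norm2_neq_0 _ H0).
  assert (Hi : continuous (fun s => / (fst (u s) ^ 2 + snd (u s) ^ 2)) x).
  { apply (continuous_comp (fun s => fst (u s) ^ 2 + snd (u s) ^ 2) Rinv).
    - exact (continuous_norm2 u x Hu).
    - exact (continuous_Rinv _ Hn). }
  destruct Hu as [H1 H2]; split.
  - exact (continuous_Rmult _ _ x H1 Hi).
  - exact (continuous_Rmult _ _ x (continuous_opp (V := R_NormedModule) _ x H2) Hi).
Qed.

Lemma continuous_is_derive (f : R -> R) (y l : R) : is_derive f y l -> continuous f y.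
Proof. intros H; apply (ex_derive_continuous (V := R_NormedModule)); eexists; exact H. Qed.

Lemma contC_Cexp u x : contC u x -> contC (fun s => Cexp (u s)) x.
Proof.
  intros [H1 H2].
  assert (He : continuous (fun s => exp (fst (u s))) x)
    by exact (continuous_comp (fun s => fst (u s)) exp x H1 (continuous_is_derive _ _ _ (is_derive_exp _))).
  assert (Hc : continuous (fun s => cos (snd (u s))) x)
    by exact (continuous_comp (fun s => snd (u s)) cos x H2 (continuous_is_derive _ _ _ (is_derive_cos _))).
  assert (Hs : continuous (fun s => sin (snd (u s))) x)
    by exact (continuous_comp (fun s => snd (u s)) sin x H2 (continuous_is_derive _ _ _ (is_derive_sin _))).
  split; [exact (continuous_Rmult _ _ x He Hc) | exact (continuous_Rmult _ _ x He Hs)].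
Qed.

Lemma contC_Clog u x : contC u x -> 0 < fst (u x) -> contC (fun s => Clog (u s)) x.
Proof.
  intros [H1 H2] Hp.
  assert (L := continuous_pos_locally _ _ H1 Hp).
  assert (Hq : 0 < fst (u x) ^ 2 + snd (u x) ^ 2) by nra.
  assert (Hm := Cmod_right_pos _ Hp).
  split.
  - apply (continuous_comp (fun s => Cmod (u s)) ln).
    + apply (continuous_comp (fun s => fst (u s) ^ 2 + snd (u s) ^ 2) sqrt).
      * exact (continuous_norm2 u x (conj H1 H2)).
      * apply continuous_sqrt.
    + eapply continuous_is_derive, is_derive_ln, Hm.
  - apply continuous_ext_loc with (fun s => atan (snd (u s) / fst (u s))).
    { revert L; apply filter_imp; intros s Hs; rewrite Clog_right by exact Hs; reflexivity. }
    apply (continuous_comp (fun s => snd (u s) / fst (u s)) atan).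
    + apply continuous_Rmult; [assumption|].
      apply (continuous_comp (fun s => fst (u s)) Rinv); [assumption|].
      apply continuous_Rinv; lra.
    + eapply continuous_is_derive, is_derive_atan.
Qed.

End ContC.

(** * A syntax for the integrands *)

(* [Inv k] stands for 1 / (1 + eps (log z + k)), where eps is a parameter: eps = 1 gives the
   factors of the transform, eps = - 1 / log t those of the rescaled one. *)
Inductive expr : Type :=
| Cst (c : C) | Eps | Log | Inv (k : R) | Pow (v : R) | Ex (th : R)
| Add (e1 e2 : expr) | Mul (e1 e2 : expr).

Definition den (eps k : R) (z : C) : C :=
  (RtoC 1 + RtoC eps * (Clog z + RtoC k))%C.

Fixpoint ev (eps : R) (e : expr) (z : C) : C :=
  match e with
  | Cst c => c
  | Eps => RtoC eps
  | Log => Clog z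
  | Inv k => (/ den eps k z)%C
  | Pow v => Cpow_neg v z
  | Ex th => Cexp (RtoC th * z)%C
  | Add e1 e2 => (ev eps e1 z + ev eps e2 z)%C
  | Mul e1 e2 => (ev eps e1 z * ev eps e2 z)%C
  end.

(** On Re z > 0, which is always assumed separately, a vanishing denominator of [Inv] is the only
    possible singularity. *)
Fixpoint ok (eps : R) (e : expr) (z : C) : Prop :=
  match e with
  | Inv k => den eps k z <> 0%C
  | Add e1 e2 | Mul e1 e2 => ok eps e1 z /\ ok eps e2 z
  | _ => True
  end.

Definition sq (e : expr) : expr := Mul e e.

(** The complex derivative in z, with [Pow 1] for 1 / z. Since the result is again an expression,
    its continuity comes from the same induction as that of [e]. *)
Fixpoint D (e : expr) : expr :=
  match e with
  | Cst _ | Eps => Cst 0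
  | Log => Pow 1
  | Inv k => Mul (Mul (Cst (RtoC (-1))) Eps) (Mul (sq (Inv k)) (Pow 1))
  | Pow v => Mul (Cst (RtoC (- v))) (Pow (v + 1))
  | Ex th => Mul (Cst (RtoC th)) (Ex th)
  | Add e1 e2 => Add (D e1) (D e2)
  | Mul e1 e2 => Add (Mul (D e1) e2) (Mul e1 (D e2))
  end.

Lemma ok_D eps e z : ok eps e z -> ok eps (D e) z.
Proof. induction e; simpl; tauto. Qed.

Lemma derC_ext u v x l m :
  (forall s, u s = v s) -> l = m -> derC u x l -> derC v x m.
Proof.
  intros H <- [H1 H2]; split;
    [apply is_derive_ext with (2 := H1) | apply is_derive_ext with (2 := H2)];
    intros s; rewrite H; reflexivity.
Qed.

Lemma RtoC_m1 : RtoC (-1) = (- RtoC 1)%C.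
Proof. apply C_ext; simpl; ring. Qed.

(** Taking an arbitrary curve [g] covers horizontal and vertical segments at once; that both
    derivatives come from the one expression [D e] is the Cauchy-Riemann relation. *)
Lemma derC_ev eps e (g : R -> C) x l :
  derC g x l -> 0 < fst (g x) -> ok eps e (g x) ->
  derC (fun s => ev eps e (g s)) x (l * ev eps (D e) (g x))%C.
Proof.
  intros Hg Hp.
  assert (Hn : g x <> 0%C) by (intros E; rewrite E in Hp; simpl in Hp; lra).
  assert (HL := derC_Clog _ _ _ Hg Hp).
  induction e; simpl; intros Hok.
  - eapply derC_ext; [reflexivity| |apply derC_const]; ring.
  - eapply derC_ext; [reflexivity| |apply derC_const]; ring.
  - eapply derC_ext; [reflexivity| |exact HL]; rewrite Cpow_neg_1 by exact Hp; reflexivity.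
  - eapply derC_ext; [reflexivity| |apply derC_inv; [|exact Hok]].
    2: { apply derC_plus; [apply derC_const|]; apply derC_mult; [apply derC_const|].
         apply derC_plus; [exact HL|apply derC_const]. }
    rewrite Cpow_neg_1 by exact Hp.
    rewrite RtoC_m1; field; split; [exact Hn|exact Hok].
  - rewrite Cpow_neg_plus, Cpow_neg_1 by exact Hp.
    change (derC (fun s => Cexp (RtoC (- v) * Clog (g s))%C) x
      (l * (RtoC (- v) * (Cexp (RtoC (- v) * Clog (g x)) * / g x)))%C).
    eapply derC_ext; [reflexivity| |apply derC_Cexp, derC_mult; [apply derC_const|exact HL]].
    cbv beta; field; exact Hn.
  - eapply derC_ext; [reflexivity| |apply derC_Cexp, derC_mult; [apply derC_const|exact Hg]].
    cbv beta; ring.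
  - destruct Hok; eapply derC_ext; [reflexivity| |apply derC_plus; [apply IHe1|apply IHe2]; assumption].
    ring.
  - destruct Hok; eapply derC_ext; [reflexivity| |apply derC_mult; [apply IHe1|apply IHe2]; assumption].
    cbv beta; ring.
Qed.

Lemma contC_ev {U : UniformSpace} eps e (g : U -> C) x :
  contC g x -> 0 < fst (g x) -> ok eps e (g x) -> contC (fun s => ev eps e (g s)) x.
Proof.
  intros Hg Hp; assert (HL := contC_Clog _ _ Hg Hp).
  induction e; simpl; intros Hok.
  - apply contC_const.
  - apply contC_const.
  - exact HL.
  - apply contC_inv; [|exact Hok].
    apply contC_plus; [apply contC_const|]; apply contC_mult; [apply contC_const|].
    apply contC_plus; [exact HL|apply contC_const].
  - apply contC_Cexp, contC_mult; [apply contC_const|exact HL].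
  - apply contC_Cexp, contC_mult; [apply contC_const|exact Hg].
  - apply contC_plus; [apply IHe1|apply IHe2]; tauto.
  - apply contC_mult; [apply IHe1|apply IHe2]; tauto.
Qed.

(** * Integrals of complex-valued functions *)

Definition CI (u : R -> C) (a b : R) : C :=
  (RInt (fun s => fst (u s)) a b, RInt (fun s => snd (u s)) a b).

Definition ex_CI (u : R -> C) (a b : R) : Prop :=
  ex_RInt (fun s => fst (u s)) a b /\ ex_RInt (fun s => snd (u s)) a b.

Lemma ex_CI_cont u a b :
  (forall s, Rmin a b <= s <= Rmax a b -> contC u s) -> ex_CI u a b.
Proof.
  intros H; split; apply (ex_RInt_continuous (V := R_CompleteNormedModule));
    intros s Hs; apply H, Hs.
Qed.

Lemma CI_ext u v a b :
  (forall s, Rmin a b < s < Rmax a b -> u s = v s) -> CI u a b = CI v a b.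
Proof.
  intros H; apply C_ext; apply RInt_ext; intros s Hs; rewrite H by exact Hs; reflexivity.
Qed.

Lemma CI_plus u v a b : ex_CI u a b -> ex_CI v a b ->
  CI (fun s => (u s + v s)%C) a b = (CI u a b + CI v a b)%C.
Proof.
  intros [H1 H2] [H3 H4]; apply C_ext; simpl;
    apply (RInt_plus (V := R_CompleteNormedModule)); assumption.
Qed.

Lemma ex_CI_plus u v a b : ex_CI u a b -> ex_CI v a b -> ex_CI (fun s => (u s + v s)%C) a b.
Proof.
  intros [H1 H2] [H3 H4]; split;
    [exact (ex_RInt_plus (V := R_NormedModule) _ _ a b H1 H3)
    |exact (ex_RInt_plus (V := R_NormedModule) _ _ a b H2 H4)].
Qed.

Lemma ex_CI_mult c u a b : ex_CI u a b -> ex_CI (fun s => (c * u s)%C) a b.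
Proof.
  intros [H1 H2]; split; simpl.
  - apply (ex_RInt_minus (V := R_NormedModule));
      apply (ex_RInt_scal (V := R_NormedModule)); assumption.
  - apply (ex_RInt_plus (V := R_NormedModule));
      apply (ex_RInt_scal (V := R_NormedModule)); assumption.
Qed.

Lemma CI_mult c u a b : ex_CI u a b -> CI (fun s => (c * u s)%C) a b = (c * CI u a b)%C.
Proof.
  intros [H1 H2]; apply C_ext; simpl.
  - rewrite (RInt_minus (V := R_CompleteNormedModule) (fun s => fst c * fst (u s)) (fun s => snd c * snd (u s))).
    2,3: apply (ex_RInt_scal (V := R_NormedModule)); assumption.
    rewrite !(RInt_scal (V := R_CompleteNormedModule)) by assumption. reflexivity.
  - rewrite (RInt_plus (V := R_CompleteNormedModule) (fun s => fst c * snd (u s)) (fun s => snd c * fst (u s))).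
    2,3: apply (ex_RInt_scal (V := R_NormedModule)); assumption.
    rewrite !(RInt_scal (V := R_CompleteNormedModule)) by assumption. reflexivity.
Qed.

Lemma CI_Chasles u a b c : ex_CI u a b -> ex_CI u b c ->
  CI u a c = (CI u a b + CI u b c)%C.
Proof.
  intros [H1 H2] [H3 H4]; apply C_ext; simpl; symmetry;
    apply (RInt_Chasles (V := R_CompleteNormedModule)); assumption.
Qed.

Lemma CI_derC u du a b :
  (forall s, Rmin a b <= s <= Rmax a b -> derC u s (du s)) ->
  (forall s, Rmin a b <= s <= Rmax a b -> contC du s) ->
  CI du a b = (u b - u a)%C.
Proof.
  intros H1 H2; apply C_ext; simpl; apply is_RInt_unique;
    apply (is_RInt_derive (V := R_CompleteNormedModule) (fun s => _ (u s)));
    intros s Hs; first [apply (H1 s Hs) | apply (H2 s Hs)].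
Qed.

Lemma Cmod_CI_le u a b M : a <= b -> ex_CI u a b ->
  (forall s, a <= s <= b -> Cmod (u s) <= M) -> Cmod (CI u a b) <= 2 * ((b - a) * M).
Proof.
  intros Hab [H1 H2] H.
  assert (B : forall s, a <= s <= b -> Rabs (fst (u s)) <= M /\ Rabs (snd (u s)) <= M).
  { intros s Hs; specialize (H s Hs).
    generalize (fst_le_Cmod (u s)) (snd_le_Cmod (u s)); lra. }
  eapply Rle_trans; [apply Cmod_le_sum|]; simpl.
  assert (Rabs (RInt (fun s => fst (u s)) a b) <= (b - a) * M)
    by (apply abs_RInt_le_const; [exact Hab|exact H1|intros; apply B; assumption]).
  assert (Rabs (RInt (fun s => snd (u s)) a b) <= (b - a) * M)
    by (apply abs_RInt_le_const; [exact Hab|exact H2|intros; apply B; assumption]).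
  lra.
Qed.

(** * Cauchy's theorem for rectangles *)

(** The predicate [P] marks the region where the integrand is regular, so that nothing has to hold
    near the poles. *)
Lemma is_derive_RInt_param_cont (f df : R -> R -> R) a b x (P : R -> R -> Prop) :
  locally x (fun u => forall v, Rmin a b <= v <= Rmax a b -> P u v) ->
  (forall u v, P u v -> locally_2d (fun u v => is_derive (fun s => f s v) u (df u v)) u v) ->
  (forall u v, P u v -> continuous (fun s => f u s) v) ->
  (forall u v, P u v -> continuity_2d_pt df u v) ->
  is_derive (fun s => RInt (f s) a b) x (RInt (df x) a b).
Proof.
  intros Hx Hld Hc Hdc.
  assert (Hd : forall u v, P u v -> is_derive (fun s => f s v) u (df u v))
    by (intros u v Huv; exact (locally_2d_singleton _ _ _ (Hld u v Huv))).
  assert (Hx0 := locally_singleton _ _ Hx).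
  replace (RInt (df x) a b) with (RInt (fun t => Derive (fun u => f u t) x) a b).
  2: { apply RInt_ext; intros v Hv; apply is_derive_unique, Hd, Hx0; lra. }
  apply is_derive_RInt_param.
  - revert Hx; apply filter_imp; intros u Hu v Hv; eexists; apply Hd, Hu, Hv.
  - intros v Hv; apply continuity_2d_pt_ext_loc with df; [|apply Hdc, Hx0, Hv].
    generalize (Hld x v (Hx0 v Hv)); apply locally_2d_impl, locally_2d_forall.
    intros u w Huw; symmetry; apply is_derive_unique, Huw.
  - revert Hx; apply filter_imp; intros u Hu.
    apply (ex_RInt_continuous (V := R_CompleteNormedModule)); intros v Hv; apply Hc, Hu, Hv.
Qed.

Lemma is_derive_pair_coord (x y : R) :
  is_derive (fun s : R => s) x 1 /\ is_derive (fun _ : R => y) x 0.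
Proof. split; [apply (is_derive_id x) | apply (is_derive_const y x)]. Qed.

Lemma derC_horizontal x y : derC (fun s => (s, y) : C) x 1%C.
Proof. exact (is_derive_pair_coord x y). Qed.

Lemma derC_vertical x y : derC (fun s => (x, s) : C) y Ci.
Proof. exact (conj (proj2 (is_derive_pair_coord y x)) (proj1 (is_derive_pair_coord y x))). Qed.

Lemma contC_plane (x y : R) :
  contC (U := prod_UniformSpace R_UniformSpace R_UniformSpace) (fun z => (fst z, snd z) : C) (x, y).
Proof. split; simpl; [apply continuous_fst | apply continuous_snd]. Qed.

(** The x-derivative of the vertical integral is the vertical integral of the complex derivative,
    which the fundamental theorem evaluates as - i times the difference of the end values;
    integrating over x gives the claim. The margin from [a] to [b] makes the derivative two-sided at
    [x1] and [x2]. *)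
Lemma Cauchy_rectangle eps e (P : R -> R -> Prop) x1 x2 y1 y2 a b :
  (forall u v, P u v -> locally_2d P u v) ->
  (forall u v, P u v -> 0 < u /\ ok eps e (u, v)) ->
  a < x1 -> x1 <= x2 -> x2 < b -> y1 <= y2 ->
  (forall u v, a < u < b -> y1 <= v <= y2 -> P u v) ->
  (CI (fun y => ev eps e (x2, y)) y1 y2 - CI (fun y => ev eps e (x1, y)) y1 y2 =
   - Ci * (CI (fun x => ev eps e (x, y2)) x1 x2 - CI (fun x => ev eps e (x, y1)) x1 x2))%C.
Proof.
  intros HP Hok Ha Hx Hb Hy Hrect.
  assert (Hv : forall u, a < u < b ->
    derC (fun s => CI (fun y => ev eps e (s, y)) y1 y2) u
      (CI (fun y => ev eps (D e) (u, y)) y1 y2)).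
  { intros u Hu; split; simpl.
    - apply (is_derive_RInt_param_cont (fun s y => fst (ev eps e (s, y)))
        (fun s y => fst (ev eps (D e) (s, y))) y1 y2 u P).
      + rewrite Rmin_left, Rmax_right by exact Hy.
        apply filter_imp with (fun s => a < s < b); [intros s Hs v Hv; apply Hrect; assumption|].
        apply (open_and _ _ (open_gt a) (open_lt b)); exact Hu.
      + intros s' v' Hsv'; generalize (HP _ _ Hsv'); apply locally_2d_impl, locally_2d_forall.
        intros s v Hsv; destruct (Hok _ _ Hsv) as [H1 H2].
        destruct (derC_ev eps e (fun s => (s, v)) s 1%C (derC_horizontal s v) H1 H2) as [H3 _].
        rewrite Cmult_1_l in H3; exact H3.
      + intros s v Hsv; destruct (Hok _ _ Hsv) as [H1 H2].
        apply (contC_ev eps e (fun v => (s, v)) v); try assumption.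
        exact (derC_continuous _ _ _ (derC_vertical s v)).
      + intros s v Hsv; destruct (Hok _ _ Hsv) as [H1 H2].
        apply continuity_2d_pt_filterlim.
        destruct (contC_ev eps (D e) _ _ (contC_plane s v) H1 (ok_D _ _ _ H2)) as [H3 _]; exact H3.
    - apply (is_derive_RInt_param_cont (fun s y => snd (ev eps e (s, y)))
        (fun s y => snd (ev eps (D e) (s, y))) y1 y2 u P).
      + rewrite Rmin_left, Rmax_right by exact Hy.
        apply filter_imp with (fun s => a < s < b); [intros s Hs v Hv; apply Hrect; assumption|].
        apply (open_and _ _ (open_gt a) (open_lt b)); exact Hu.
      + intros s' v' Hsv'; generalize (HP _ _ Hsv'); apply locally_2d_impl, locally_2d_forall.
        intros s v Hsv; destruct (Hok _ _ Hsv) as [H1 H2].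
        destruct (derC_ev eps e (fun s => (s, v)) s 1%C (derC_horizontal s v) H1 H2) as [_ H3].
        rewrite Cmult_1_l in H3; exact H3.
      + intros s v Hsv; destruct (Hok _ _ Hsv) as [H1 H2].
        apply (contC_ev eps e (fun v => (s, v)) v); try assumption.
        exact (derC_continuous _ _ _ (derC_vertical s v)).
      + intros s v Hsv; destruct (Hok _ _ Hsv) as [H1 H2].
        apply continuity_2d_pt_filterlim.
        destruct (contC_ev eps (D e) _ _ (contC_plane s v) H1 (ok_D _ _ _ H2)) as [_ H3]; exact H3. }
  (* Along a vertical segment d/dy contributes a factor i, which is divided out by i * i = -1. *)
  assert (Hh : forall u, a < u < b -> CI (fun y => ev eps (D e) (u, y)) y1 y2 =
     (- Ci * (ev eps e (u, y2) - ev eps e (u, y1)))%C).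
  { intros u Hu.
    rewrite <- (CI_derC (fun y => ev eps e (u, y)) (fun y => (Ci * ev eps (D e) (u, y))%C) y1 y2).
    - rewrite CI_mult.
      + set (I := CI _ _ _); replace I with ((- (Ci * Ci)) * I)%C at 1; [ring|].
        replace (- (Ci * Ci))%C with (RtoC 1) by (apply C_ext; simpl; ring); ring.
      + apply ex_CI_cont; rewrite Rmin_left, Rmax_right by exact Hy; intros v Hvv.
        destruct (Hok u v (Hrect _ _ Hu Hvv)).
        apply (contC_ev eps (D e) (fun v => (u, v)) v); try assumption; [|apply ok_D; assumption].
        exact (derC_continuous _ _ _ (derC_vertical u v)).
    - rewrite Rmin_left, Rmax_right by exact Hy; intros v Hvv.
      destruct (Hok u v (Hrect _ _ Hu Hvv)).
      apply (derC_ev eps e (fun v => (u, v)) v); try assumption; apply derC_vertical.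
    - rewrite Rmin_left, Rmax_right by exact Hy; intros v Hvv.
      destruct (Hok u v (Hrect _ _ Hu Hvv)).
      apply contC_mult; [apply contC_const|].
      apply (contC_ev eps (D e) (fun v => (u, v)) v); try assumption; [|apply ok_D; assumption].
      exact (derC_continuous _ _ _ (derC_vertical u v)). }
  assert (Hc : forall y, y1 <= y <= y2 -> forall u, Rmin x1 x2 <= u <= Rmax x1 x2 ->
    contC (fun x => ev eps e (x, y)) u).
  { intros y Hyy u; rewrite Rmin_left, Rmax_right by exact Hx; intros Hu.
    assert (Hu' : a < u < b) by lra.
    destruct (Hok u y (Hrect _ _ Hu' Hyy)).
    apply (contC_ev eps e (fun x => (x, y)) u); try assumption.
    exact (derC_continuous _ _ _ (derC_horizontal u y)). }
  assert (E1 : ex_CI (fun x => ev eps e (x, y1)) x1 x2) by (apply ex_CI_cont, Hc; lra).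
  assert (E2 : ex_CI (fun x => ev eps e (x, y2)) x1 x2) by (apply ex_CI_cont, Hc; lra).
  rewrite <- (CI_derC (fun x => CI (fun y => ev eps e (x, y)) y1 y2)
     (fun x => (- Ci * (ev eps e (x, y2) + (RtoC (-1)) * ev eps e (x, y1)))%C) x1 x2).
  - assert (E3 := ex_CI_mult (RtoC (-1)) _ _ _ E1).
    rewrite (CI_mult (- Ci) (fun x => ev eps e (x, y2) + RtoC (-1) * ev eps e (x, y1))%C)
      by (apply ex_CI_plus; [exact E2 | exact E3]).
    rewrite (CI_plus (fun x => ev eps e (x, y2)) (fun x => RtoC (-1) * ev eps e (x, y1))%C _ _ E2 E3).
    rewrite (CI_mult (RtoC (-1)) (fun x => ev eps e (x, y1)) _ _ E1).
    rewrite RtoC_m1; ring.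
  - rewrite Rmin_left, Rmax_right by exact Hx; intros u Hu.
    assert (Hu' : a < u < b) by lra.
    eapply derC_ext; [reflexivity| |apply Hv, Hu'].
    rewrite Hh by exact Hu'; rewrite RtoC_m1; ring.
  - intros u Hu; apply contC_mult; [apply contC_const|]; apply contC_plus; [apply Hc; [lra|exact Hu]|].
    apply contC_mult; [apply contC_const|]; apply Hc; [lra|exact Hu].
Qed.

(** * Smooth functions of a real variable *)

(** Smoothness witnessed by the whole sequence of derivatives: sums and multiples are then termwise,
    and iterated [Derive_n] is handled only once. *)
Definition tower (u : R -> C) : Prop :=
  exists U : nat -> R -> C,
    (forall t, U O t = u t) /\ forall n t, derC (U n) t (U (S n) t).

Lemma tower_plus u v : tower u -> tower v -> tower (fun t => (u t + v t)%C).
Proof.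
  intros (U & U0 & HU) (V & V0 & HV); exists (fun n t => (U n t + V n t)%C); split.
  - intros t; rewrite U0, V0; reflexivity.
  - intros n t; apply derC_plus; [apply HU | apply HV].
Qed.

Lemma tower_mult c u : tower u -> tower (fun t => (c * u t)%C).
Proof.
  intros (U & U0 & HU); exists (fun n t => (c * U n t)%C); split.
  - intros t; rewrite U0; reflexivity.
  - intros n t; eapply derC_ext; [reflexivity| |apply derC_mult; [apply derC_const|apply HU]].
    cbv beta; ring.
Qed.

Lemma smooth_R_of_derivs (G : nat -> R -> R) :
  (forall n t, is_derive (G n) t (G (S n) t)) -> smooth_R (G O).
Proof.
  intros H.
  assert (E : forall n t, Derive_n (G O) n t = G n t).
  { induction n as [|n IH]; intros t; [reflexivity|]; simpl.
    rewrite (Derive_ext _ (G n)) by exact IH; apply is_derive_unique, H. }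
  intros n t; apply ex_derive_ext with (G n).
  - intros s; symmetry; apply E.
  - eexists; apply H.
Qed.

Lemma tower_smooth u : tower u -> smooth_on_closed_halfline u.
Proof.
  intros (U & U0 & HU); exists (fun t => fst (U O t)), (fun t => snd (U O t)); repeat split.
  - apply (smooth_R_of_derivs (fun n t => fst (U n t))); intros n t; apply HU.
  - apply (smooth_R_of_derivs (fun n t => snd (U n t))); intros n t; apply HU.
  - intros t _; rewrite U0; apply surjective_pairing.
Qed.

Lemma continuous_2d_of_snd (f : R -> R) (x y : R) :
  continuous f y -> continuous (fun z : R * R => f (snd z)) (x, y).
Proof.
  intros H; apply (continuous_comp (fun z : R * R => snd z) f); [apply continuous_snd | exact H].
Qed.

(** Each t-derivative multiplies the density by [z s] and leaves an integral of the same shape, so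
    one differentiation with arbitrary continuous density [psi] yields all orders. *)
Lemma tower_CI_exp (z phi : R -> C) a b :
  (forall s, Rmin a b <= s <= Rmax a b -> contC z s) ->
  (forall s, Rmin a b <= s <= Rmax a b -> contC phi s) ->
  tower (fun t => CI (fun s => (Cexp (RtoC t * z s) * phi s)%C) a b).
Proof.
  intros Hz Hphi.
  set (K phi t := CI (fun s => (Cexp (RtoC t * z s) * phi s)%C) a b).
  assert (HK : forall psi, (forall s, Rmin a b <= s <= Rmax a b -> contC psi s) ->
    forall t, derC (K psi) t (K (fun s => (z s * psi s)%C) t)).
  { clear phi Hphi; intros psi Hpsi t.
    set (f u v := (Cexp (RtoC u * z v) * psi v)%C).
    set (df u v := (Cexp (RtoC u * z v) * (z v * psi v))%C).
    assert (Hd : forall u v, derC (fun s => f s v) u (df u v)).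
    { intros u v; unfold f, df.
      eapply derC_ext; [reflexivity| |apply derC_mult; [apply derC_Cexp, derC_mult; [|apply derC_const]|apply derC_const]].
      2: { instantiate (1 := RtoC 1); exact (is_derive_pair_coord u 0). }
      cbv beta; ring. }
    assert (Hc : forall u v, Rmin a b <= v <= Rmax a b -> contC (fun s => f u s) v).
    { intros u v Hv; unfold f; apply contC_mult; [|apply Hpsi, Hv].
      apply contC_Cexp, contC_mult; [apply contC_const|apply Hz, Hv]. }
    assert (Hdc : forall u v, Rmin a b <= v <= Rmax a b ->
      contC (U := prod_UniformSpace R_UniformSpace R_UniformSpace) (fun w => df (fst w) (snd w)) (u, v)).
    { intros u v Hv.
      assert (Cz : contC (U := prod_UniformSpace R_UniformSpace R_UniformSpace) (fun w => z (snd w)) (u, v)).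
      { destruct (Hz v Hv) as [H1 H2].
        exact (conj (continuous_2d_of_snd (fun s => fst (z s)) u v H1)
                    (continuous_2d_of_snd (fun s => snd (z s)) u v H2)). }
      assert (Cp : contC (U := prod_UniformSpace R_UniformSpace R_UniformSpace) (fun w => psi (snd w)) (u, v)).
      { destruct (Hpsi v Hv) as [H1 H2].
        exact (conj (continuous_2d_of_snd (fun s => fst (psi s)) u v H1)
                    (continuous_2d_of_snd (fun s => snd (psi s)) u v H2)). }
      unfold df; apply contC_mult; [|apply contC_mult; assumption].
      apply contC_Cexp, contC_mult; [|exact Cz].
      split; [apply continuous_fst | apply continuous_const]. }
    split; simpl.
    - apply (is_derive_RInt_param_cont (fun u v => fst (f u v)) (fun u v => fst (df u v)) a b t
        (fun u v => Rmin a b <= v <= Rmax a b)).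
      + apply filter_forall; tauto.
      + intros u v _; apply locally_2d_forall; intros; apply Hd.
      + intros u v Hv; apply (Hc u v Hv).
      + intros u v Hv; apply continuity_2d_pt_filterlim, (Hdc u v Hv).
    - apply (is_derive_RInt_param_cont (fun u v => snd (f u v)) (fun u v => snd (df u v)) a b t
        (fun u v => Rmin a b <= v <= Rmax a b)).
      + apply filter_forall; tauto.
      + intros u v _; apply locally_2d_forall; intros; apply Hd.
      + intros u v Hv; apply (Hc u v Hv).
      + intros u v Hv; apply continuity_2d_pt_filterlim, (Hdc u v Hv). }
  set (phin := fix phin n := match n with O => phi | S n => fun s => (z s * phin n s)%C end).
  exists (fun n => K (phin n)); split; [reflexivity|].
  intros n; apply (HK (phin n)); clear HK; induction n as [|n IH]; [exact Hphi|].
  intros s Hs; apply contC_mult; [apply Hz, Hs | apply IH, Hs].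
Qed.

(** * Limits and absolutely convergent integrals *)

Definition limC (u : R -> C) (l : C) : Prop :=
  is_lim (fun L => fst (u L)) p_infty (fst l) /\ is_lim (fun L => snd (u L)) p_infty (snd l).

(** Agreement is asked only for L >= 1, because the contour can be deformed only when its horizontal
    ends lie beyond the notch of half-height 1. *)
Lemma limC_ext u v l m : (forall L, 1 <= L -> u L = v L) -> l = m -> limC u l -> limC v m.
Proof.
  intros H <- [H1 H2]; split;
    [apply is_lim_ext_loc with (2 := H1) | apply is_lim_ext_loc with (2 := H2)];
    exists 1; intros L HL; rewrite H by lra; reflexivity.
Qed.

Lemma limC_plus u v l m : limC u l -> limC v m -> limC (fun L => (u L + v L)%C) (l + m)%C.
Proof.
  intros [H1 H2] [H3 H4]; split; simpl; apply is_lim_plus'; assumption.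
Qed.

Lemma limC_mult c u l : limC u l -> limC (fun L => (c * u L)%C) (c * l)%C.
Proof.
  intros [H1 H2]; split; simpl.
  - apply is_lim_minus'; [exact (is_lim_scal_l _ (fst c) _ _ H1)|exact (is_lim_scal_l _ (snd c) _ _ H2)].
  - apply is_lim_plus'; [exact (is_lim_scal_l _ (fst c) _ _ H2)|exact (is_lim_scal_l _ (snd c) _ _ H1)].
Qed.

Lemma limC_const c : limC (fun _ => c) c.
Proof. split; apply is_lim_const. Qed.

Lemma limC_scale c u l : 0 < c -> limC u l -> limC (fun L => u (c * L)) l.
Proof.
  intros Hc Hu.
  assert (Hl : is_lim (fun L => c * L) p_infty p_infty).
  { apply is_lim_spec; intros M; exists (M / c); intros L HL.
    apply (Rmult_lt_compat_l c) in HL; [|exact Hc].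
    replace (c * (M / c)) with M in HL by (field; lra); exact HL. }
  assert (Hn : Rbar_locally' p_infty (fun y => Finite (c * y) <> p_infty)) by (exists 0; discriminate).
  destruct Hu as [H1 H2]; split;
    [exact (is_lim_comp (fun L => fst (u L)) _ _ _ _ H1 Hl Hn)
    |exact (is_lim_comp (fun L => snd (u L)) _ _ _ _ H2 Hl Hn)].
Qed.

Definition vanishing (u : R -> C) : Prop :=
  forall eta, 0 < eta -> exists Y, forall L, Y <= L -> Cmod (u L) <= eta.

Lemma limC_vanishing u : vanishing u -> limC u 0%C.
Proof.
  intros H; split; apply is_lim_spec; intros eps;
    destruct (H (eps / 2)) as [Y HY]; try (destruct eps; simpl; lra);
    exists Y; intros L HL; simpl; rewrite Rminus_0_r;
    (eapply Rle_lt_trans; [first [apply fst_le_Cmod | apply snd_le_Cmod] |]);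
    (eapply Rle_lt_trans; [apply HY; lra|]); destruct eps; simpl; lra.
Qed.

(** The dominating function has an explicit primitive, so tails are controlled by differences of
    arctangents. *)
Lemma abs_RInt_le_atan (v : R -> R) M a b :
  (forall y, continuous v y) -> (forall y, Rabs (v y) <= M / (1 + y²)) -> a <= b ->
  Rabs (RInt v a b) <= M * (atan b - atan a).
Proof.
  intros Hc Hb Hab.
  apply (norm_RInt_le v (fun y => M * / (1 + y²)) a b); [exact Hab|intros y _; exact (Hb y)| |].
  - apply (RInt_correct (V := R_CompleteNormedModule)).
    apply (ex_RInt_continuous (V := R_CompleteNormedModule)); intros; apply Hc.
  - apply (is_RInt_scal (V := R_NormedModule) (fun y => / (1 + y²)) a b M).
    apply (is_RInt_derive (V := R_CompleteNormedModule) atan); intros y _; [apply is_derive_atan|].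
    assert (1 + y² <> 0) by (generalize (Rle_0_sqr y); lra).
    eapply continuous_is_derive; unfold Rsqr in *; auto_derive; [assumption|reflexivity].
Qed.

Lemma is_lim_monotone_bounded (w : R -> R) B :
  (forall x y, 0 <= x <= y -> w x <= w y) -> (forall x, 0 <= x -> w x <= B) ->
  exists l, is_lim w p_infty (Finite l).
Proof.
  intros Hm Hb.
  destruct (completeness (fun z => exists x, 0 <= x /\ z = w x)) as [l [Hl1 Hl2]].
  - exists B; intros z (x & Hx & ->); apply Hb, Hx.
  - exists (w 0), 0; split; [lra|reflexivity].
  - exists l; apply is_lim_spec; intros eps.
    destruct (Classical_Prop.classic (exists x, 0 <= x /\ l - eps < w x)) as [(x & Hx & Hw)|Hn].
    + exists x; intros y Hy.
      assert (w x <= w y) by (apply Hm; lra).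
      assert (w y <= l) by (apply Hl1; exists y; split; [lra|reflexivity]).
      apply Rabs_def1; lra.
    + exfalso; assert (l <= l - eps); [|destruct eps; simpl in *; lra].
      apply Hl2; intros z (x & Hx & ->); apply Rnot_lt_le; intros Hlt.
      apply Hn; exists x; split; assumption.
Qed.

Lemma is_lim_atan : is_lim atan p_infty (PI / 2).
Proof.
  apply is_lim_spec; intros eps.
  assert (HPI := PI_RGT_0).
  (* The cap 1 < PI / 2 keeps PI / 2 - e in the range where [atan] inverts [tan]. *)
  set (e := Rmin eps 1).
  assert (He : 0 < e /\ e <= eps /\ e <= 1).
  { unfold e; repeat split; [apply Rmin_pos; [apply eps|lra]|apply Rmin_l|apply Rmin_r]. }
  assert (PI / 2 > 1) by (generalize PI2_1; lra).
  exists (tan (PI / 2 - e)); intros x Hx.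
  apply atan_increasing in Hx; rewrite atan_tan in Hx by lra.
  generalize (atan_bound x); intros; apply Rabs_def1; lra.
Qed.

Lemma is_lim_RInt_dominated (v : R -> R) M :
  (forall y, continuous v y) -> (forall y, Rabs (v y) <= M / (1 + y²)) ->
  exists l, is_lim (fun L => RInt v (- L) L) p_infty (Finite l) /\ Rabs l <= M * PI.
Proof.
  intros Hc Hb.
  assert (Hex : forall a b, ex_RInt v a b)
    by (intros; apply (ex_RInt_continuous (V := R_CompleteNormedModule)); intros; apply Hc).
  assert (HM : 0 <= M).
  { generalize (Hb 0) (Rabs_pos (v 0)); unfold Rsqr; rewrite Rmult_0_l, Rplus_0_r, Rdiv_1_r; lra. }
  assert (Hmon : forall x, 0 <= x -> Rabs (RInt v (- x) x) <= M * PI).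
  { intros x Hx; eapply Rle_trans; [exact (abs_RInt_le_atan v M (- x) x Hc Hb ltac:(lra))|].
    rewrite atan_opp; apply Rmult_le_compat_l; [exact HM|generalize (atan_bound x); lra]. }
  (* The added term is the integral of M / (1 + y^2) over [-L, L]. It makes the integrand
     nonnegative, hence the sum monotone in L; its own limit is subtracted afterwards. The bound is
     M PI from each of the two terms. *)
  destruct (is_lim_monotone_bounded (fun L => RInt v (- L) L + 2 * M * atan L) (2 * (M * PI))) as [l Hl].
  - intros x y Hxy.
    assert (E1 := RInt_Chasles (V := R_CompleteNormedModule) v (- y) (- x) y (Hex _ _) (Hex _ _)).
    assert (E2 := RInt_Chasles (V := R_CompleteNormedModule) v (- x) x y (Hex _ _) (Hex _ _)).
    unfold plus in E1, E2; simpl in E1, E2.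
    assert (A1 := abs_RInt_le_atan v M (- y) (- x) Hc Hb ltac:(lra)).
    assert (A2 := abs_RInt_le_atan v M x y Hc Hb ltac:(lra)).
    rewrite !atan_opp in A1; apply Rabs_le_between in A1, A2; lra.
  - intros x Hx; specialize (Hmon x Hx); apply Rabs_le_between in Hmon.
    generalize (atan_bound x); nra.
  - exists (l - 2 * M * (PI / 2)).
    assert (Hlim : is_lim (fun L => RInt v (- L) L) p_infty (l - 2 * M * (PI / 2))).
    { apply is_lim_ext with (fun L => (RInt v (- L) L + 2 * M * atan L) - 2 * M * atan L);
        [intros; ring|].
      apply is_lim_minus'; [exact Hl|].
      exact (is_lim_scal_l atan (2 * M) p_infty _ is_lim_atan). }
    split; [exact Hlim|].
    apply Rabs_le_between; split.
    + apply (is_lim_le_loc (fun _ => - (M * PI)) (fun L => RInt v (- L) L) p_infty (- (M * PI)) (l - 2 * M * (PI / 2)));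
        [|apply is_lim_const|exact Hlim].
      exists 0; intros x Hx; specialize (Hmon x ltac:(lra)); apply Rabs_le_between in Hmon; lra.
    + apply (is_lim_le_loc (fun L => RInt v (- L) L) (fun _ => M * PI) p_infty (l - 2 * M * (PI / 2)) (M * PI));
        [|exact Hlim|apply is_lim_const].
      exists 0; intros x Hx; specialize (Hmon x ltac:(lra)); apply Rabs_le_between in Hmon; lra.
Qed.

Lemma limC_CI_dominated (v : R -> C) M :
  (forall y, contC v y) -> (forall y, Cmod (v y) <= M / (1 + y²)) ->
  exists l, limC (fun L => CI v (- L) L) l /\ Cmod l <= 2 * (M * PI).
Proof.
  intros Hc Hb.
  destruct (is_lim_RInt_dominated (fun y => fst (v y)) M) as (l1 & H1 & B1).
  { exact (fun y => proj1 (Hc y)). }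
  { intros y; eapply Rle_trans; [apply fst_le_Cmod | apply Hb]. }
  destruct (is_lim_RInt_dominated (fun y => snd (v y)) M) as (l2 & H2 & B2).
  { exact (fun y => proj2 (Hc y)). }
  { intros y; eapply Rle_trans; [apply snd_le_Cmod | apply Hb]. }
  exists (l1, l2); split; [split; assumption|].
  eapply Rle_trans; [apply Cmod_le_sum|]; simpl; lra.
Qed.

(** * Symbols in the logarithm *)

(** Expressions built from log z and the rescaled factors alone: they grow more slowly than every
    power of |z|, uniformly in small eps. Powers of z and exponentials are always split off
    first. *)
Fixpoint symbol (K : R) (e : expr) : Prop :=
  match e with
  | Cst _ | Eps | Log => True
  | Inv k => Rabs k <= K
  | Add e1 e2 | Mul e1 e2 => symbol K e1 /\ symbol K e2
  | _ => False
  end.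

(** Differentiation of a symbol with respect to the variable log z, hence again a symbol. *)
Fixpoint dlog (e : expr) : expr :=
  match e with
  | Log => Cst 1
  | Inv k => Mul (Mul (Cst (RtoC (-1))) Eps) (sq (Inv k))
  | Add e1 e2 => Add (dlog e1) (dlog e2)
  | Mul e1 e2 => Add (Mul (dlog e1) e2) (Mul e1 (dlog e2))
  | _ => Cst 0
  end.

(** The value at eps = 0 kept as an expression, since [rest] of a product needs it as a factor. *)
Fixpoint at0 (e : expr) : expr :=
  match e with
  | Eps => Cst 0
  | Inv _ => Cst 1
  | Add e1 e2 => Add (at0 e1) (at0 e2)
  | Mul e1 e2 => Mul (at0 e1) (at0 e2)
  | _ => e
  end.

(* The first-order Taylor quotient in eps: e = at0 e + eps * rest e. *)
Fixpoint rest (e : expr) : expr :=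
  match e with
  | Eps => Cst 1
  | Inv k => Mul (Cst (RtoC (-1))) (Mul (Add Log (Cst (RtoC k))) (Inv k))
  | Add e1 e2 => Add (rest e1) (rest e2)
  | Mul e1 e2 => Add (Mul (rest e1) e2) (Mul (at0 e1) (rest e2))
  | _ => Cst 0
  end.

Lemma symbol_at0 K e : symbol K e -> symbol K (at0 e).
Proof. induction e; simpl; tauto. Qed.

Lemma symbol_rest K e : symbol K e -> symbol K (rest e).
Proof.
  induction e; simpl; try tauto.
  intros [H1 H2]; generalize (symbol_at0 K _ H1); tauto.
Qed.

Lemma symbol_dlog K e : symbol K e -> symbol K (dlog e).
Proof. induction e; simpl; tauto. Qed.

Lemma ev_at0 eps e z : ev eps (at0 e) z = ev 0 e z.
Proof.
  induction e; simpl; try reflexivity; try congruence.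
  unfold den; rewrite Cmult_0_l, Cplus_0_r; field.
Qed.

(** The source is 1 / (1 + eps w) = 1 - eps w / (1 + eps w); products use the discrete Leibniz rule.
    The quotient is again a symbol, so the division can be repeated to any order. *)
Lemma ev_rest eps e z :
  ok eps e z -> ev eps e z = (ev 0 e z + RtoC eps * ev eps (rest e) z)%C.
Proof.
  induction e; intros Hok; try (simpl; ring).
  - simpl in *; unfold den at 2; rewrite Cmult_0_l, Cplus_0_r.
    replace (/ RtoC 1)%C with (den eps k z * / den eps k z)%C.
    2: { field; exact Hok. }
    unfold den at 2; rewrite RtoC_m1; ring.
  - simpl in *; rewrite IHe1, IHe2 by tauto; ring.
  - simpl in *; rewrite ev_at0.
    assert (E1 := IHe1 (proj1 Hok)); assert (E2 := IHe2 (proj2 Hok)).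
    set (b := ev eps e2 z) in *; rewrite E1.
    transitivity (ev 0 e1 z * b + RtoC eps * (ev eps (rest e1) z * b))%C; [ring|].
    rewrite E2 at 1; ring.
Qed.

Lemma ev_D_symbol K eps e z :
  symbol K e -> ev eps (D e) z = (Cpow_neg 1 z * ev eps (dlog e) z)%C.
Proof.
  induction e; simpl; try tauto; intros H; try ring.
  - destruct H; rewrite IHe1, IHe2 by assumption; ring.
  - destruct H; rewrite IHe1, IHe2 by assumption; ring.
Qed.

(** The symbol that remains when z^(-v) e is differentiated and z^(-v-1) is taken out. *)
Definition step (v : R) (e : expr) : expr := Add (dlog e) (Mul (Cst (RtoC (- v))) e).

Lemma symbol_step K v e : symbol K e -> symbol K (step v e).
Proof. intros H; generalize (symbol_dlog K e H); simpl; tauto. Qed.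

Lemma ev_D_Pow K eps v e z : symbol K e ->
  ev eps (D (Mul (Pow v) e)) z = ev eps (Mul (Pow (v + 1)) (step v e)) z.
Proof.
  intros H; simpl; rewrite (ev_D_symbol K) by exact H.
  rewrite !Cpow_neg_plus; ring.
Qed.

Lemma Rpower_ge_1 x a : 1 <= x -> 0 <= a -> 1 <= Rpower x a.
Proof.
  intros Hx Ha; rewrite <- (Rpower_O x) by lra.
  destruct (Req_dec x 1) as [->|Hn].
  - unfold Rpower; rewrite ln_1, !Rmult_0_r; lra.
  - apply Rle_Rpower; lra.
Qed.

(** From exp u >= 1 + u at u = a ln x. *)
Lemma ln_le_Rpower x a : 1 <= x -> 0 < a -> ln x <= / a * Rpower x a.
Proof.
  intros Hx Ha; unfold Rpower; generalize (exp_ineq1_le (a * ln x)); intros H.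
  apply (Rmult_le_compat_l (/ a)) in H; [|left; apply Rinv_0_lt_compat, Ha].
  replace (/ a * (1 + a * ln x)) with (/ a + ln x) in H by (field; lra).
  assert (0 < / a) by (apply Rinv_0_lt_compat, Ha); lra.
Qed.

Lemma Cmod_Clog_le (z : C) : 0 < fst z -> Cmod (Clog z) <= Rabs (ln (Cmod z)) + 2.
Proof.
  intros H; rewrite Clog_right by exact H; eapply Rle_trans; [apply Cmod_le_sum|]; simpl.
  generalize (atan_bound (snd z / fst z)) PI_4; intros H1 H2.
  apply Rplus_le_compat_l, Rabs_le_between; lra.
Qed.

Lemma den_ge (eps k : R) (z : C) :
  0 < fst z -> 1 + eps * (ln (Cmod z) + k) <= Cmod (den eps k z).
Proof.
  intros H; eapply Rle_trans; [|apply fst_le_Cmod]; eapply Rle_trans; [|apply RRle_abs].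
  unfold den; rewrite Clog_right by exact H; simpl; lra.
Qed.

(** * Uniform bounds and integration by parts on the line Re z = 1 *)

Section UniformBounds.
Context (K eps0 : R).
Context (HK : 0 <= K) (Heps0 : eps0 <= 1) (HepsK : eps0 * K <= / 2).

Lemma ln_ge_0 x : 1 <= x -> 0 <= ln x.
Proof. intros H; rewrite <- ln_1; apply ln_le; lra. Qed.

(** For |z| >= 1 the real part of log z is nonnegative, so the real part of the denominator is at
    least 1 - eps K; this is the purpose of [HepsK]. *)
Lemma den_ge_half eps k (z : C) : 0 <= eps <= eps0 -> Rabs k <= K -> 0 < fst z -> 1 <= Cmod z ->
  / 2 <= Cmod (den eps k z).
Proof.
  intros He Hk Hp Hz; eapply Rle_trans; [|apply den_ge; exact Hp].
  apply Rabs_le_between in Hk; assert (0 <= ln (Cmod z)) by (apply ln_ge_0; exact Hz).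
  assert (eps * - K <= eps * (ln (Cmod z) + k)) by (apply Rmult_le_compat_l; lra).
  assert (eps * K <= eps0 * K) by (apply Rmult_le_compat_r; lra); lra.
Qed.

Lemma ok_symbol eps e z : symbol K e -> 0 <= eps <= eps0 -> 0 < fst z -> 1 <= Cmod z -> ok eps e z.
Proof.
  intros Hs He Hp Hz; induction e; simpl in *; try tauto.
  intros E; generalize (den_ge_half eps k z He Hs Hp Hz); rewrite E, Cmod_0; lra.
Qed.

(** The exponent [eta] is quantified inside the induction because a product gives half of it to each
    factor. The constant does not depend on eps, and eps = 0 is included. *)
Lemma symbol_bound e : symbol K e -> forall eta, 0 < eta ->
  exists B, 0 <= B /\ forall eps z, 0 <= eps <= eps0 -> 0 < fst z -> 1 <= Cmod z ->
    Cmod (ev eps e z) <= B * Rpower (Cmod z) eta.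
Proof.
  induction e; simpl; try contradiction; intros Hs eta Heta.
  - exists (Cmod c); split; [apply Cmod_ge_0|]; intros eps z _ _ Hz.
    rewrite <- (Rmult_1_r (Cmod c)) at 1; apply Rmult_le_compat_l; [apply Cmod_ge_0|].
    apply Rpower_ge_1; lra.
  - exists 1; split; [lra|]; intros eps z He _ Hz; rewrite Cmod_R, Rabs_right by lra.
    generalize (Rpower_ge_1 (Cmod z) eta Hz); lra.
  - assert (0 < / eta) by (apply Rinv_0_lt_compat, Heta).
    exists (/ eta + 2); split; [lra|]; intros eps z _ Hp Hz.
    eapply Rle_trans; [apply Cmod_Clog_le, Hp|].
    rewrite Rabs_right by (apply Rle_ge, ln_ge_0, Hz).
    generalize (ln_le_Rpower (Cmod z) eta Hz Heta) (Rpower_ge_1 (Cmod z) eta Hz); lra.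
  - exists 2; split; [lra|]; intros eps z He Hp Hz.
    assert (Hd := den_ge_half eps k z He Hs Hp Hz).
    rewrite Cmod_inv by (intros E; rewrite E, Cmod_0 in Hd; lra).
    apply Rle_trans with 2; [|generalize (Rpower_ge_1 (Cmod z) eta Hz); lra].
    rewrite <- (Rinv_inv 2); apply Rinv_le_contravar; [lra|exact Hd].
  - destruct Hs as [Hs1 Hs2].
    destruct (IHe1 Hs1 eta Heta) as (B1 & HB1 & H1), (IHe2 Hs2 eta Heta) as (B2 & HB2 & H2).
    exists (B1 + B2); split; [lra|]; intros eps z He Hp Hz.
    eapply Rle_trans; [apply Cmod_triangle|].
    generalize (H1 eps z He Hp Hz) (H2 eps z He Hp Hz); lra.
  - destruct Hs as [Hs1 Hs2].
    destruct (IHe1 Hs1 (eta / 2)) as (B1 & HB1 & H1); [lra|].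
    destruct (IHe2 Hs2 (eta / 2)) as (B2 & HB2 & H2); [lra|].
    exists (B1 * B2); split; [apply Rmult_le_pos; assumption|]; intros eps z He Hp Hz.
    rewrite Cmod_mult; replace eta with (eta / 2 + eta / 2) by field; rewrite Rpower_plus.
    replace (B1 * B2 * (_ * _)) with
      ((B1 * Rpower (Cmod z) (eta / 2)) * (B2 * Rpower (Cmod z) (eta / 2))) by ring.
    apply Rmult_le_compat; try apply Cmod_ge_0; [apply H1|apply H2]; assumption.
Qed.

Lemma Cmod_line (y : R) : 1 <= Cmod (1, y) /\ Rabs y <= Cmod (1, y) /\ Cmod (1, y) * Cmod (1, y) = 1 + y².
Proof.
  assert (H1 := fst_le_Cmod (1, y)); assert (H2 := snd_le_Cmod (1, y)); simpl in H1, H2.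
  rewrite Rabs_R1 in H1; repeat split; try assumption.
  unfold Cmod; simpl fst; simpl snd; rewrite sqrt_sqrt; [unfold Rsqr; ring|nra].
Qed.

Lemma Rpower_neg_small a eta : 0 < a -> 0 < eta ->
  exists Y, 1 <= Y /\ forall x, Y <= x -> Rpower x (- a) <= eta.
Proof.
  intros Ha He; exists (Rmax 1 (exp (- ln eta / a))); split; [apply Rmax_l|]; intros x Hx.
  assert (Hx1 := Rle_trans _ _ _ (Rmax_l _ _) Hx); assert (Hx2 := Rle_trans _ _ _ (Rmax_r _ _) Hx).
  apply ln_le in Hx2; [|apply exp_pos]; rewrite ln_exp in Hx2.
  apply (Rmult_le_compat_l a) in Hx2; [|lra].
  replace (a * (- ln eta / a)) with (- ln eta) in Hx2 by (field; lra).
  unfold Rpower; rewrite <- (exp_ln eta) by exact He.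
  destruct (Req_dec (- a * ln x) (ln eta)) as [->|Hn]; [lra|left; apply exp_increasing; lra].
Qed.

(** After rescaling, [th] is t exp Lam. It stays free because convergence for every t > 0 is proved
    with a fixed Lam, while the asymptotics take th = 1. *)
Definition line_integral (th eps : R) (e : expr) (L : R) : C :=
  CI (fun y => ev eps (Mul (Ex th) e) (1, y)) (- L) L.

Lemma contC_line eps e y : ok eps e (1, y) -> contC (fun y => ev eps e (1, y)) y.
Proof.
  intros H; apply (contC_ev eps e (fun y => (1, y)) y); [|simpl; lra|exact H].
  exact (derC_continuous _ _ _ (derC_vertical 1 y)).
Qed.

(** On Re z = 1 the exponential has constant modulus exp th, so the boundary terms vanish as soon as
    [e] does at both ends. *)
Lemma integration_by_parts th eps e l : th <> 0 ->
  (forall y, ok eps e (1, y)) ->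
  vanishing (fun L => ev eps e (1, L)) -> vanishing (fun L => ev eps e (1, - L)) ->
  limC (line_integral th eps (D e)) l ->
  limC (line_integral th eps e) (- / RtoC th * l)%C.
Proof.
  intros Hth Hok V1 V2 Hl.
  assert (Hth' : RtoC th <> 0%C) by (intros E; apply (f_equal fst) in E; simpl in E; lra).
  assert (HX : forall y, ok eps (Mul (Ex th) e) (1, y)) by (intros y; split; [exact I|apply Hok]).
  assert (Hc : forall e', (forall y, ok eps e' (1, y)) ->
    forall L, ex_CI (fun y => ev eps (Mul (Ex th) e') (1, y)) (- L) L).
  { intros e' He' L; apply ex_CI_cont; intros y _; apply contC_line; split; [exact I|apply He']. }
  assert (Hb : forall V, vanishing (fun L => ev eps e (1, V L)) ->
    limC (fun L => ev eps (Mul (Ex th) e) (1, V L)) 0%C).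
  { intros V HV; apply limC_vanishing; intros eta Heta.
    assert (Hexp := exp_pos th).
    destruct (HV (eta / exp th)) as [Y HY]; [apply Rdiv_lt_0_compat; assumption|].
    exists Y; intros L HL; simpl; rewrite Cmod_mult, Cmod_Cexp; simpl.
    replace (th * 1 - 0 * V L) with th by ring.
    specialize (HY L HL); apply (Rmult_le_compat_l (exp th)) in HY; [|lra].
    replace (exp th * (eta / exp th)) with eta in HY by (field; lra); exact HY. }
  eapply limC_ext; cycle 2.
  - apply limC_plus; [|exact (limC_mult (- / RtoC th)%C _ _ Hl)].
    apply (limC_mult (- Ci / RtoC th)%C).
    apply limC_plus; [exact (Hb (fun L => L) V1)|].
    apply (limC_mult (RtoC (-1))), (Hb (fun L => - L) V2).
  - intros L _; cbv beta.
    assert (E : CI (fun y => (Ci * ev eps (D (Mul (Ex th) e)) (1, y))%C) (- L) L =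
      (ev eps (Mul (Ex th) e) (1, L) - ev eps (Mul (Ex th) e) (1, (- L)%R))%C).
    { apply (CI_derC (fun y => ev eps (Mul (Ex th) e) (1, y))).
      - intros y _; apply (derC_ev eps (Mul (Ex th) e) (fun y => (1, y)) y);
          [apply derC_vertical|simpl; lra|apply HX].
      - intros y _; apply contC_mult; [apply contC_const|].
        apply contC_line, ok_D, HX. }
    rewrite (CI_ext _ (fun y => (Ci * RtoC th * ev eps (Mul (Ex th) e) (1, y) +
       Ci * ev eps (Mul (Ex th) (D e)) (1, y))%C)) in E by (intros; simpl; ring).
    rewrite (CI_plus (fun y => (Ci * RtoC th * ev eps (Mul (Ex th) e) (1, y))%C)
       (fun y => (Ci * ev eps (Mul (Ex th) (D e)) (1, y))%C)) in E.
    2: apply ex_CI_mult, Hc, Hok.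
    2: apply ex_CI_mult, Hc; intros; apply ok_D, Hok.
    rewrite (CI_mult (Ci * RtoC th) (fun y => ev eps (Mul (Ex th) e) (1, y))) in E by apply Hc, Hok.
    rewrite (CI_mult Ci (fun y => ev eps (Mul (Ex th) (D e)) (1, y))) in E
      by (apply Hc; intros; apply ok_D, Hok).
    unfold line_integral.
    replace (ev eps (Mul (Ex th) e) (1, L) + RtoC (-1) * ev eps (Mul (Ex th) e) (1, (- L)%R))%C
      with (ev eps (Mul (Ex th) e) (1, L) - ev eps (Mul (Ex th) e) (1, (- L)%R))%C
      by (rewrite RtoC_m1; ring).
    rewrite <- E.
    set (A := CI _ _ _); set (A' := CI _ _ _).
    transitivity (- (Ci * Ci) * A + (- (Ci * Ci) - RtoC 1) * A' / RtoC th)%C; [field; exact Hth'|].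
    replace (- (Ci * Ci))%C with (RtoC 1) by (apply C_ext; simpl; ring); field; exact Hth'.
  - cbv beta; ring.
Qed.

Lemma vanishing_Pow_symbol eps v e : symbol K e -> 0 <= eps <= eps0 -> 0 < v ->
  vanishing (fun L => ev eps (Mul (Pow v) e) (1, L)) /\
  vanishing (fun L => ev eps (Mul (Pow v) e) (1, (- L)%R)).
Proof.
  intros Hs He Hv.
  (* Half of the decay pays for the symbol, the other half tends to 0. *)
  destruct (symbol_bound e Hs (v / 2)) as (B & HB & H); [lra|].
  assert (G : forall eta, 0 < eta -> exists Y, forall y, Y <= Rabs y ->
    Cmod (ev eps (Mul (Pow v) e) (1, y)) <= eta).
  { intros eta Heta.
    (* Dividing by B + 1 instead of B covers the case B = 0. *)
    destruct (Rpower_neg_small (v / 2) (eta / (B + 1))) as (Y & HY1 & HY);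
      [lra|apply Rdiv_lt_0_compat; lra|].
    exists Y; intros y Hy; destruct (Cmod_line y) as (L1 & L2 & _).
    assert (Hp : 0 < fst (1, y)) by (simpl; lra).
    specialize (HY (Cmod (1, y)) ltac:(lra)).
    simpl ev; rewrite Cmod_mult, Cmod_Cpow_neg by exact Hp.
    specialize (H eps (1, y) He Hp L1).
    apply Rle_trans with (Rpower (Cmod (1, y)) (- v) * (B * Rpower (Cmod (1, y)) (v / 2))).
    { apply Rmult_le_compat_l; [left; apply exp_pos|exact H]. }
    replace (- v) with (- (v / 2) + - (v / 2)) by field; rewrite Rpower_plus.
    rewrite (Rpower_Ropp _ (v / 2)) at 2.
    assert (HP : 0 < Rpower (Cmod (1, y)) (v / 2)) by apply exp_pos.
    replace (_ * _ * _) with (B * Rpower (Cmod (1, y)) (- (v / 2))) by (field; lra).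
    apply Rle_trans with (B * (eta / (B + 1))); [apply Rmult_le_compat_l; lra|].
    apply Rmult_le_reg_r with (B + 1); [lra|].
    replace (B * (eta / (B + 1)) * (B + 1)) with (B * eta) by (field; lra); nra. }
  split; intros eta Heta; destruct (G eta Heta) as [Y HY]; exists (Rmax Y 0); intros L HL;
    apply HY; generalize (Rmax_l Y 0) (Rmax_r Y 0); intros;
    rewrite ?Rabs_Ropp, Rabs_right; lra.
Qed.

Lemma line_integral_cv th v e : symbol K e -> 3 <= v -> exists M, forall eps, 0 <= eps <= eps0 ->
  exists l, limC (line_integral th eps (Mul (Pow v) e)) l /\ Cmod l <= M.
Proof.
  (* With eta = 1 and v >= 3 the integrand is at most a multiple of |z|^-2, which is exactly 1 / (1
     + y^2) on this line. *)
  intros Hs Hv; destruct (symbol_bound e Hs 1) as (B & HB & H); [lra|].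
  exists (2 * (exp th * B * PI)); intros eps He.
  apply limC_CI_dominated.
  - intros y; apply contC_line; destruct (Cmod_line y); repeat split.
    apply ok_symbol; try assumption; simpl; lra.
  - intros y; destruct (Cmod_line y) as (L1 & _ & L3).
    assert (Hp : 0 < fst (1, y)) by (simpl; lra).
    specialize (H eps (1, y) He Hp L1).
    simpl ev; rewrite !Cmod_mult, Cmod_Cexp, Cmod_Cpow_neg by exact Hp.
    replace (fst (RtoC th * (1, y))%C) with th by (simpl; ring).
    unfold Rdiv; rewrite Rmult_assoc; apply Rmult_le_compat_l; [left; apply exp_pos|].
    apply Rle_trans with (Rpower (Cmod (1, y)) (- v) * (B * Rpower (Cmod (1, y)) 1)).
    { apply Rmult_le_compat_l; [left; apply exp_pos|exact H]. }
    rewrite <- L3.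
    replace (_ * (B * _)) with (B * Rpower (Cmod (1, y)) (- v + 1)) by (rewrite Rpower_plus; ring).
    apply Rmult_le_compat_l; [exact HB|].
    apply Rle_trans with (Rpower (Cmod (1, y)) (- (1 + 1))).
    + apply Rle_Rpower; lra.
    + rewrite Rpower_Ropp, Rpower_plus, Rpower_1 by lra; lra.
Qed.

End UniformBounds.

(** * Expansion of the line integral in powers of eps *)

Definition limit_value (u : R -> C) : C :=
  (real (Lim (fun L => fst (u L)) p_infty), real (Lim (fun L => snd (u L)) p_infty)).

Lemma limit_value_eq u l : limC u l -> limit_value u = l.
Proof.
  intros [H1 H2]; apply is_lim_unique in H1, H2; apply C_ext;
    [exact (f_equal real H1) | exact (f_equal real H2)].
Qed.

Definition J (v : R) (e : expr) (eps : R) : C :=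
  limit_value (line_integral 1 eps (Mul (Pow v) e)).

Section Expansion.
Context (K eps0 v : R).
Context (HK : 0 <= K) (Heps0 : 0 <= eps0 <= 1) (HepsK : eps0 * K <= / 2) (Hv : 3 <= v).

Lemma J_spec e : symbol K e -> exists M, forall eps, 0 <= eps <= eps0 ->
  limC (line_integral 1 eps (Mul (Pow v) e)) (J v e eps) /\ Cmod (J v e eps) <= M.
Proof.
  intros Hs; destruct (line_integral_cv K eps0 HK (proj2 Heps0) HepsK 1 v e Hs Hv) as [M HM].
  exists M; intros eps He; destruct (HM eps He) as (l & H1 & H2).
  unfold J; rewrite (limit_value_eq _ _ H1); split; assumption.
Qed.

Lemma ok_line e eps y : symbol K e -> 0 <= eps <= eps0 -> ok eps e (1, y).
Proof.
  intros Hs He; destruct (Cmod_line y); apply (ok_symbol K eps0); try assumption;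
    simpl; lra.
Qed.

Lemma J_rest e eps : symbol K e -> 0 <= eps <= eps0 ->
  J v e eps = (J v e 0 + RtoC eps * J v (rest e) eps)%C.
Proof.
  intros Hs He; assert (Hr := symbol_rest K e Hs).
  destruct (J_spec e Hs) as [M HM]; destruct (J_spec (rest e) Hr) as [M' HM'].
  apply limit_value_eq.
  eapply limC_ext; cycle 2.
  - apply limC_plus; [exact (proj1 (HM 0 ltac:(lra)))|].
    apply (limC_mult (RtoC eps)); exact (proj1 (HM' eps He)).
  - intros L _; cbv beta; unfold line_integral.
    rewrite <- CI_mult, <- CI_plus.
    + apply CI_ext; intros y _; simpl; rewrite (ev_rest eps e) by (apply ok_line; assumption); ring.
    + apply ex_CI_cont; intros y _; apply contC_line; repeat split; apply ok_line; [assumption|lra].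
    + apply ex_CI_mult, ex_CI_cont; intros y _; apply contC_line; repeat split; apply ok_line; assumption.
    + apply ex_CI_cont; intros y _; apply contC_line; repeat split; apply ok_line; assumption.
  - reflexivity.
Qed.

Definition restn (k : nat) (e : expr) : expr := Nat.iter k rest e.

Lemma symbol_restn k e : symbol K e -> symbol K (restn k e).
Proof. intros H; induction k; simpl; [exact H|apply symbol_rest, IHk]. Qed.

(** An exact identity: the remainder is [J] of another symbol, so [J_spec] bounds it uniformly in
    eps. *)
Lemma J_expansion N e eps : symbol K e -> 0 <= eps <= eps0 ->
  J v e eps = (Csum_lt (fun k => RtoC (eps ^ k) * J v (restn k e) 0)%C N +
    RtoC (eps ^ N) * J v (restn N e) eps)%C.
Proof.
  intros Hs He; induction N as [|N IH]; simpl Csum_lt.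
  - simpl; ring.
  - rewrite IH at 1; rewrite (J_rest (restn N e)) by (try apply symbol_restn; assumption).
    change (rest (restn N e)) with (restn (S N) e); simpl pow; rewrite RtoC_mult; ring.
Qed.

End Expansion.

(** * Three integrations by parts *)

Lemma line_integral_ext th eps e e' L :
  (forall y, ev eps e (1, y) = ev eps e' (1, y)) -> line_integral th eps e L = line_integral th eps e' L.
Proof. intros H; apply CI_ext; intros y _; simpl; rewrite H; reflexivity. Qed.

Definition step3 (v : R) (e : expr) : expr := step (v + 1 + 1) (step (v + 1) (step v e)).

Lemma symbol_step3 K v e : symbol K e -> symbol K (step3 v e).
Proof. intros H; exact (symbol_step K _ _ (symbol_step K _ _ (symbol_step K _ _ H))). Qed.

(** For v = 0 the power gives no decay, so the vanishing of the first boundary terms is a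
    hypothesis; at exponents v + 1 and v + 2 it follows from the symbol bounds. *)
Lemma line_integral_by_parts3 K eps0 eps th v e l :
  0 <= K -> eps0 <= 1 -> eps0 * K <= / 2 -> 0 <= eps <= eps0 -> 0 < th -> 0 <= v -> symbol K e ->
  vanishing (fun L => ev eps (Mul (Pow v) e) (1, L)) ->
  vanishing (fun L => ev eps (Mul (Pow v) e) (1, - L)) ->
  limC (line_integral th eps (Mul (Pow (v + 1 + 1 + 1)) (step3 v e))) l ->
  limC (line_integral th eps (Mul (Pow v) e))
    (- / RtoC th * (- / RtoC th * (- / RtoC th * l)))%C.
Proof.
  intros HK H0 H0K He Hth Hv Hs V1 V2 Hl.
  assert (Hok : forall u e', symbol K e' -> forall y, ok eps (Mul (Pow u) e') (1, y)).
  { intros u e' Hs' y; split; [exact I|]; destruct (Cmod_line y).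
    apply (ok_symbol K eps0); try assumption; simpl; lra. }
  assert (G : forall u e' l', symbol K e' ->
    vanishing (fun L => ev eps (Mul (Pow u) e') (1, L)) ->
    vanishing (fun L => ev eps (Mul (Pow u) e') (1, - L)) ->
    limC (line_integral th eps (Mul (Pow (u + 1)) (step u e'))) l' ->
    limC (line_integral th eps (Mul (Pow u) e')) (- / RtoC th * l')%C).
  { intros u e' l' Hs' V1' V2' Hl'; apply integration_by_parts; try assumption; [lra|apply Hok, Hs'|].
    eapply limC_ext; [|reflexivity|exact Hl'].
    intros L _; apply line_integral_ext; intros y; symmetry; apply (ev_D_Pow K), Hs'. }
  assert (V : forall u e', 0 < u -> symbol K e' ->
    vanishing (fun L => ev eps (Mul (Pow u) e') (1, L)) /\
    vanishing (fun L => ev eps (Mul (Pow u) e') (1, - L)))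
    by (intros u e' Hu Hs'; apply (vanishing_Pow_symbol K eps0); assumption).
  assert (S1 := symbol_step K v e Hs); assert (S2 := symbol_step K (v + 1) _ S1).
  destruct (V (v + 1) _ ltac:(lra) S1) as [A1 A2].
  destruct (V (v + 1 + 1) _ ltac:(lra) S2) as [B1 B2].
  exact (G v e _ Hs V1 V2 (G _ _ _ S1 A1 A2 (G _ _ _ S2 B1 B2 Hl))).
Qed.

(** * The transform as a symbol *)

Fixpoint epow (e : expr) (n : nat) : expr :=
  match n with O => Cst 1 | S n => Mul e (epow e n) end.

Fixpoint eprod (f : nat -> expr) (a n : nat) : expr :=
  match n with O => Cst 1 | S n => Mul (f a) (eprod f (S a) n) end.

Definition log_factor (kap : nat -> R) (alpha : nat -> nat) (q : nat) : expr :=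
  eprod (fun k => epow (Inv (kap k)) (alpha k)) 1 q.

(** A factor with exponent 0 has no pole; the guard lets the contour pass through exp (- kappa_k)
    when alpha_k = 0. *)
Lemma ok_epow eps e n z : ((0 < n)%nat -> ok eps e z) -> ok eps (epow e n) z.
Proof.
  intros H; induction n as [|n IH]; simpl; [exact I|].
  split; [apply H; lia|apply IH; intros _; apply H; lia].
Qed.

Lemma ok_eprod eps f a n z :
  (forall k, (a <= k < a + n)%nat -> ok eps (f k) z) -> ok eps (eprod f a n) z.
Proof.
  revert a; induction n as [|n IH]; intros a H; simpl; [exact I|].
  split; [apply H; lia|apply IH; intros k Hk; apply H; lia].
Qed.

Lemma symbol_log_factor K kap alpha q :
  (forall k, (1 <= k <= q)%nat -> Rabs (kap k) <= K) -> symbol K (log_factor kap alpha q).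
Proof.
  unfold log_factor; intros H.
  assert (H' : forall k, (1 <= k < 1 + q)%nat -> Rabs (kap k) <= K) by (intros; apply H; lia).
  revert H'; generalize 1%nat; induction q as [|n IH]; intros a Ha; simpl; [exact I|].
  split; [|apply IH; [intros k Hk; apply H; lia|intros k Hk; apply Ha; lia]].
  generalize (Ha a ltac:(lia)); intros Hk; induction (alpha a); simpl; tauto.
Qed.

Lemma RtoC_1_neq_0 : RtoC 1 <> 0%C.
Proof. intros E; apply (f_equal fst) in E; simpl in E; lra. Qed.

Lemma Cpown_neq_0 (z : C) n : ((0 < n)%nat -> z <> 0%C) -> Cpown z n <> 0%C.
Proof.
  intros H; induction n as [|n IH]; simpl; [exact RtoC_1_neq_0|].
  apply Cmult_neq_0; [apply H; lia|apply IH; intros _; apply H; lia].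
Qed.

Lemma ev_epow_Inv eps k n z : ((0 < n)%nat -> den eps k z <> 0%C) ->
  ev eps (epow (Inv k) n) z = (/ Cpown (den eps k z) n)%C.
Proof.
  intros H; induction n as [|n IH]; simpl.
  - field; exact RtoC_1_neq_0.
  - simpl in IH; rewrite IH by (intros _; apply H; lia); field.
    split; [apply Cpown_neq_0; intros _; apply H; lia | apply H; lia].
Qed.

(** Used with c = 1 for the transform itself and with c = 1 / Lam for the rescaled one, where the
    scalars collect to (1 / Lam)^|alpha|. *)
Lemma Cprod_from_scaled_ev eps (g : nat -> C) (f : nat -> expr) (c : R) (m : nat -> nat) a n z :
  (forall k, (a <= k < a + n)%nat -> g k = (RtoC (c ^ m k) * ev eps (f k) z)%C) ->
  Cprod_from g a n = (RtoC (c ^ nsum_from m a n) * ev eps (eprod f a n) z)%C.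
Proof.
  revert a; induction n as [|n IH]; intros a H; simpl; [ring|].
  rewrite H, (IH (S a)) by (try (intros k Hk; apply H); lia).
  rewrite pow_add, RtoC_mult; ring.
Qed.

Lemma Cprod_from_Cexp (c : nat -> R) a n (w : C) :
  Cprod_from (fun k => Cexp (RtoC (- c k) * w)%C) a n = Cexp (RtoC (- rsum_from c a n) * w)%C.
Proof.
  revert a; induction n as [|n IH]; intros a; simpl.
  - rewrite Ropp_0, Cmult_0_l; symmetry; apply Cexp_0.
  - rewrite IH, <- Cexp_plus; f_equal; rewrite !RtoC_opp, RtoC_plus; ring.
Qed.

Lemma T_ab_eq p q kappa nu alpha beta z :
  T_ab p q kappa nu alpha beta z =
  (Cprod_from (fun k => / Cpown (Clog z + RtoC (kappa k)) (alpha k)) 1 q *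
   Cpow_neg (nu_beta p q nu beta) z)%C.
Proof.
  unfold T_ab; f_equal.
  apply (Cprod_from_Cexp (fun k => INR (beta k) * nu k)).
Qed.

(** If log z is the real number - k, then arg z = 0, so z is the positive number exp (- k). *)
Lemma Clog_plus_neq_0 (z : C) (k : R) :
  0 < fst z -> snd z <> 0 \/ fst z <> exp (- k) -> (Clog z + RtoC k)%C <> 0%C.
Proof.
  intros Hp H E; rewrite Clog_right in E by exact Hp.
  assert (E1 := f_equal fst E); assert (E2 := f_equal snd E); simpl in E1, E2.
  assert (Hy : snd z / fst z = 0).
  { rewrite <- (tan_atan (snd z / fst z)), <- tan_0; f_equal; lra. }
  assert (Hs : snd z = 0).
  { replace (snd z) with (snd z / fst z * fst z) by (field; lra); rewrite Hy; ring. }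
  destruct H as [H|H]; [exact (H Hs)|]; apply H.
  replace (- k) with (ln (Cmod z)) by lra.
  rewrite exp_ln by (apply Cmod_right_pos, Hp).
  replace z with (RtoC (fst z)) at 2 by (apply C_ext; simpl; auto).
  rewrite Cmod_R, Rabs_right; lra.
Qed.

(** At eps = 1 the denominator of [Inv k] is 1 + log z + k; shifting kappa by 1 gives log z +
    kappa. *)
Definition transform_expr p q (kappa nu : nat -> R) (alpha beta : nat -> nat) : expr :=
  Mul (log_factor (fun k => kappa k - 1) alpha q) (Pow (nu_beta p q nu beta)).

Lemma den_1 k z : den 1 (k - 1) z = (Clog z + RtoC k)%C.
Proof. unfold den; rewrite RtoC_minus; ring. Qed.

Lemma ok_transform p q kappa nu alpha beta z : 0 < fst z ->
  (forall k, (1 <= k <= q)%nat -> (0 < alpha k)%nat -> snd z <> 0 \/ fst z <> exp (- kappa k)) ->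
  ok 1 (transform_expr p q kappa nu alpha beta) z.
Proof.
  intros Hp H; split; [|exact I]; apply ok_eprod; intros k Hk; apply ok_epow; intros Ha.
  simpl; rewrite den_1; apply Clog_plus_neq_0; [exact Hp|apply H; [lia|exact Ha]].
Qed.

Lemma T_ab_ev p q kappa nu alpha beta z : 0 < fst z ->
  (forall k, (1 <= k <= q)%nat -> (0 < alpha k)%nat -> snd z <> 0 \/ fst z <> exp (- kappa k)) ->
  T_ab p q kappa nu alpha beta z = ev 1 (transform_expr p q kappa nu alpha beta) z.
Proof.
  intros Hp H; rewrite T_ab_eq.
  rewrite (Cprod_from_scaled_ev 1 _ (fun k => epow (Inv (kappa k - 1)) (alpha k)) 1 alpha 1 q z).
  - rewrite pow1; simpl; unfold log_factor; ring.
  - intros k Hk; rewrite pow1, ev_epow_Inv, den_1; [ring|].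
    intros Ha; rewrite den_1; apply Clog_plus_neq_0; [exact Hp|apply H; [lia|exact Ha]].
Qed.

Lemma Cpown_scal (c : R) (z : C) n : Cpown (RtoC c * z)%C n = (RtoC (c ^ n) * Cpown z n)%C.
Proof. induction n as [|n IH]; simpl; [ring|rewrite IH, RtoC_mult; ring]. Qed.

Lemma T_ab_scaled p q kappa nu alpha beta Lam z : 0 < Lam -> 0 < fst z ->
  (forall k, (1 <= k <= q)%nat -> den (/ Lam) (kappa k) z <> 0%C) ->
  T_ab p q kappa nu alpha beta (RtoC (exp Lam) * z)%C =
  (RtoC (exp (- nu_beta p q nu beta * Lam) * (/ Lam) ^ abs_alpha q alpha) *
   ev (/ Lam) (Mul (Pow (nu_beta p q nu beta)) (log_factor kappa alpha q)) z)%C.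
Proof.
  intros HL Hp H; rewrite T_ab_eq.
  assert (Hlog : Clog (RtoC (exp Lam) * z)%C = (RtoC Lam + Clog z)%C).
  { rewrite Clog_scale, ln_exp; [reflexivity|apply exp_pos|exact Hp]. }
  rewrite (Cprod_from_scaled_ev (/ Lam) _ (fun k => epow (Inv (kappa k)) (alpha k)) (/ Lam) alpha 1 q z).
  - unfold Cpow_neg; rewrite Hlog, Cmult_plus_distr_l, Cexp_plus.
    replace (Cexp (RtoC (- nu_beta p q nu beta) * RtoC Lam)%C)
      with (RtoC (exp (- nu_beta p q nu beta * Lam))).
    2: { rewrite <- RtoC_mult; apply C_ext; unfold Cexp; simpl; rewrite ?cos_0, ?sin_0; ring. }
    rewrite RtoC_mult; simpl; unfold log_factor, Cpow_neg, abs_alpha; ring.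
  - intros k Hk; rewrite Hlog, ev_epow_Inv by (intros _; apply H; lia).
    assert (HL' : RtoC Lam <> 0%C) by (intros E; apply (f_equal fst) in E; simpl in E; lra).
    replace (RtoC Lam + Clog z + RtoC (kappa k))%C with (RtoC Lam * den (/ Lam) (kappa k) z)%C.
    2: { unfold den; rewrite RtoC_inv by lra; field; exact HL'. }
    rewrite Cpown_scal, pow_inv, RtoC_inv by (apply pow_nonzero; lra); field; split.
    + apply Cpown_neq_0; intros _; apply H; lia.
    + intros E; apply (f_equal fst) in E; simpl in E; revert E; apply pow_nonzero; lra.
Qed.

(** * Decay of the transform at infinity *)

Lemma Cmod_Cpown (z : C) n : Cmod (Cpown z n) = Cmod z ^ n.
Proof. induction n as [|n IH]; simpl; [apply Cmod_1|rewrite Cmod_mult, IH; reflexivity]. Qed.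

Lemma Clog_plus_ge (z : C) k M : 0 < fst z -> exp (M + Rabs k) <= Cmod z -> M <= Cmod (Clog z + RtoC k)%C.
Proof.
  intros Hp HM; eapply Rle_trans; [|apply fst_le_Cmod]; eapply Rle_trans; [|apply RRle_abs].
  rewrite Clog_right by exact Hp; simpl.
  apply ln_le in HM; [|apply exp_pos]; rewrite ln_exp in HM.
  generalize (Rle_abs (- k)); rewrite Rabs_Ropp; lra.
Qed.

(** The bound by 1 is needed beside the bound by [eta]: it controls the other factors, in the
    induction and when the decay comes from the power of z. *)
Lemma log_product_small kappa alpha a n eta : 0 < eta -> exists Y, forall z, 0 < fst z -> Y <= Cmod z ->
  Cmod (Cprod_from (fun k => / Cpown (Clog z + RtoC (kappa k)) (alpha k))%C a n) <= 1 /\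
  ((exists k, (a <= k < a + n)%nat /\ (0 < alpha k)%nat) ->
   Cmod (Cprod_from (fun k => / Cpown (Clog z + RtoC (kappa k)) (alpha k))%C a n) <= eta).
Proof.
  intros Heta; revert a; induction n as [|n IH]; intros a.
  - exists 0; intros z _ _; simpl; rewrite Cmod_1; split; [lra|intros (k & Hk & _); lia].
  - destruct (IH (S a)) as [Y HY].
    (* M >= 1 makes the new factor at most 1, and M >= 1 / eta makes it at most eta when its
       exponent is positive. *)
    set (M := 1 + / eta); assert (HM : 0 < / eta) by (apply Rinv_0_lt_compat, Heta).
    exists (Rmax Y (exp (M + Rabs (kappa a)))); intros z Hp Hz.
    destruct (HY z Hp (Rle_trans _ _ _ (Rmax_l _ _) Hz)) as [H1 H2].
    assert (Hw := Clog_plus_ge z (kappa a) M Hp (Rle_trans _ _ _ (Rmax_r _ _) Hz)).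
    assert (Hmod : Cmod (/ Cpown (Clog z + RtoC (kappa a)) (alpha a))%C =
      / Cmod (Clog z + RtoC (kappa a))%C ^ alpha a).
    { rewrite Cmod_inv, Cmod_Cpown; [reflexivity|].
      apply Cpown_neq_0; intros _ E; rewrite E, Cmod_0 in Hw; unfold M in Hw; lra. }
    assert (F1 : Cmod (/ Cpown (Clog z + RtoC (kappa a)) (alpha a))%C <= 1).
    { rewrite Hmod, <- Rinv_1; apply Rinv_le_contravar; [lra|].
      apply pow_R1_Rle; unfold M in Hw; lra. }
    assert (F2 : (0 < alpha a)%nat -> Cmod (/ Cpown (Clog z + RtoC (kappa a)) (alpha a))%C <= eta).
    { intros Ha; rewrite Hmod, <- (Rinv_inv eta); apply Rinv_le_contravar; [exact HM|].
      destruct (alpha a) as [|m]; [lia|]; simpl.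
      assert (1 <= Cmod (Clog z + RtoC (kappa a))%C ^ m) by (apply pow_R1_Rle; unfold M in Hw; lra).
      unfold M in Hw; nra. }
    simpl; rewrite Cmod_mult.
    set (A := Cmod (/ _)%C) in *; set (B := Cmod (Cprod_from _ _ _)) in *.
    assert (HA : 0 <= A) by apply Cmod_ge_0; assert (HB : 0 <= B) by apply Cmod_ge_0.
    split; [nra|]; intros (k & Hk & Ha).
    destruct (Nat.eq_dec k a) as [->|Hka].
    + specialize (F2 Ha); nra.
    + assert (B <= eta) by (apply H2; exists k; split; [lia|exact Ha]); nra.
Qed.

Lemma rsum_from_ge (c : nat -> R) a n :
  (forall k, (a <= k < a + n)%nat -> 0 <= c k) ->
  0 <= rsum_from c a n /\ forall k, (a <= k < a + n)%nat -> c k <= rsum_from c a n.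
Proof.
  revert a; induction n as [|n IH]; intros a H; simpl; [split; [lra|intros; lia]|].
  destruct (IH (S a)) as [H1 H2]; [intros k Hk; apply H; lia|].
  assert (H0 := H a ltac:(lia)); split; [lra|]; intros k Hk.
  destruct (Nat.eq_dec k a) as [->|Hka]; [lra|].
  specialize (H2 k ltac:(lia)); lra.
Qed.

(** One positive exponent of either kind makes the transform tend to 0. With all exponents 0 it is
    the constant 1, whose Bromwich integral diverges for t > 0. *)
Lemma T_ab_small p q kappa nu alpha beta eta :
  (q <= p)%nat -> (forall k, (S q <= k <= p)%nat -> 0 < nu k < 1) ->
  (exists k, (1 <= k <= q)%nat /\ (0 < alpha k)%nat) \/
  (exists k, (S q <= k <= p)%nat /\ (0 < beta k)%nat) ->
  0 < eta -> exists Y, forall z, 0 < fst z -> Y <= Cmod z ->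
  Cmod (T_ab p q kappa nu alpha beta z) <= eta.
Proof.
  intros Hqp Hnu Hnt Heta.
  destruct (log_product_small kappa alpha 1 q eta Heta) as [Y HY].
  assert (Hc : forall k, (S q <= k < S q + (p - q))%nat -> 0 <= INR (beta k) * nu k).
  { intros k Hk; apply Rmult_le_pos; [apply pos_INR|left; apply Hnu; lia]. }
  destruct (rsum_from_ge _ _ _ Hc) as [Hv0 Hvk]; fold (nu_beta p q nu beta) in Hv0, Hvk.
  destruct Hnt as [(k & Hk & Ha) | (k & Hk & Hb)].
  - exists (Rmax Y 1); intros z Hp Hz.
    destruct (HY z Hp (Rle_trans _ _ _ (Rmax_l _ _) Hz)) as [_ H2].
    rewrite T_ab_eq, Cmod_mult, Cmod_Cpow_neg by exact Hp.
    rewrite <- (Rmult_1_r eta); apply Rmult_le_compat;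
      [apply Cmod_ge_0|left; apply exp_pos|apply H2; exists k; split; [lia|exact Ha]|].
    rewrite <- (Rpower_O (Cmod z)) by (apply Cmod_right_pos, Hp).
    apply Rle_Rpower; [exact (Rle_trans _ _ _ (Rmax_r _ _) Hz)|lra].
  - assert (Hpos : 0 < nu_beta p q nu beta).
    { apply Rlt_le_trans with (INR (beta k) * nu k); [|apply Hvk; lia].
      apply Rmult_lt_0_compat; [apply lt_0_INR; exact Hb|apply Hnu, Hk]. }
    destruct (Rpower_neg_small _ _ Hpos Heta) as (Y2 & _ & HY2).
    exists (Rmax Y Y2); intros z Hp Hz.
    destruct (HY z Hp (Rle_trans _ _ _ (Rmax_l _ _) Hz)) as [H1 _].
    rewrite T_ab_eq, Cmod_mult, Cmod_Cpow_neg by exact Hp.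
    rewrite <- (Rmult_1_l eta); apply Rmult_le_compat;
      [apply Cmod_ge_0|left; apply exp_pos|exact H1|].
    apply HY2; exact (Rle_trans _ _ _ (Rmax_r _ _) Hz).
Qed.

(** * Deformation of the contour *)

Lemma locally_2d_fst_gt c x y : c < x -> locally_2d (fun u _ => c < u) x y.
Proof.
  intros H; assert (Hd : 0 < x - c) by lra.
  exists (mkposreal _ Hd); intros u v Hu _; simpl in Hu; apply Rabs_def2 in Hu; lra.
Qed.

Lemma locally_2d_snd_neq_0 x y : y <> 0 -> locally_2d (fun _ v => v <> 0) x y.
Proof.
  intros H; exists (mkposreal _ (Rabs_pos_lt y H)); intros u v _ Hv E; simpl in Hv.
  rewrite E, Rminus_0_l, Rabs_Ropp in Hv; lra.
Qed.

Lemma CI_scale (u : R -> C) c a b : (forall y, contC u y) ->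
  CI u (c * a) (c * b) = (RtoC c * CI (fun y => u (c * y)%R) a b)%C.
Proof.
  intros Hu.
  assert (G : forall f : R -> R, (forall y, continuous f y) ->
    RInt f (c * a) (c * b) = c * RInt (fun y => f (c * y)) a b).
  { intros f Hf.
    assert (E := RInt_comp_lin (V := R_CompleteNormedModule) f c 0 a b).
    rewrite !Rplus_0_r in E; rewrite <- E.
    2: apply (ex_RInt_continuous (V := R_CompleteNormedModule)); intros; apply Hf.
    transitivity (RInt (fun y => scal c (f (c * y))) a b).
    2: apply (RInt_scal (V := R_CompleteNormedModule) (fun y => f (c * y)) a b c).
    - apply RInt_ext; intros y _; rewrite Rplus_0_r; reflexivity.
    - apply (ex_RInt_continuous (V := R_CompleteNormedModule)); intros y _.
      apply (continuous_comp (fun y => c * y) f); [|apply Hf].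
      apply (continuous_scal_r (V := R_NormedModule) c (fun y => y)), continuous_id. }
  assert (G1 := G (fun y => fst (u y)) (fun y => proj1 (Hu y))).
  assert (G2 := G (fun y => snd (u y)) (fun y => proj2 (Hu y))).
  apply C_ext; simpl; [rewrite G1 | rewrite G2]; ring.
Qed.

Lemma kappa_bound (kappa : nat -> R) q :
  exists K, 0 <= K /\ forall k, (1 <= k <= q)%nat -> Rabs (kappa k) <= K.
Proof.
  induction q as [|q (K & HK & H)]; [exists 0; split; [lra|intros; lia]|].
  exists (Rmax K (Rabs (kappa (S q)))); split.
  - eapply Rle_trans; [exact HK|apply Rmax_l].
  - intros k Hk; destruct (Nat.eq_dec k (S q)) as [->|Hn]; [apply Rmax_r|].
    eapply Rle_trans; [apply H; lia|apply Rmax_l].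
Qed.

(* The integral over Re z = exp Lam is rescaled by z = exp Lam * s, so that log z = Lam + log s;
   the asymptotics as t -> 0 use Lam = - ln t, and Lam0 is a value from which on all poles lie
   to the left. *)
Section Transform.
Context (p q : nat) (kappa nu : nat -> R) (alpha beta : nat -> nat) (delta K Lam0 : R).
Context (Hqp : (q <= p)%nat) (Hnu : forall k, (S q <= k <= p)%nat -> 0 < nu k < 1)
  (Hdelta : 0 < delta)
  (Hpole : forall k, (1 <= k <= q)%nat -> (0 < alpha k)%nat -> delta <> exp (- kappa k))
  (Hnontriv : (exists k, (1 <= k <= q)%nat /\ (0 < alpha k)%nat) \/
              (exists k, (S q <= k <= p)%nat /\ (0 < beta k)%nat))
  (HK : 0 <= K) (HkK : forall k, (1 <= k <= q)%nat -> Rabs (kappa k) <= K)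
  (HLam1 : 1 + 2 * K <= Lam0) (HLamd : delta < exp Lam0).

Let F := T_ab p q kappa nu alpha beta.
Let FE := transform_expr p q kappa nu alpha beta.
Let nb := nu_beta p q nu beta.
Let a := abs_alpha q alpha.
Let Lf := log_factor kappa alpha q.

Definition regular (z : C) : Prop := 0 < fst z /\
  forall k, (1 <= k <= q)%nat -> (0 < alpha k)%nat -> snd z <> 0 \/ fst z <> exp (- kappa k).

Lemma regular_delta y : regular (delta, y).
Proof. split; [exact Hdelta|]; intros k Hk Ha; right; simpl; apply Hpole; assumption. Qed.

Lemma regular_off_axis x y : 0 < x -> y <> 0 -> regular (x, y).
Proof. intros Hx Hy; split; [exact Hx|]; intros; left; exact Hy. Qed.

Lemma regular_right x y : exp K < x -> regular (x, y).
Proof.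
  intros Hx; split; simpl; [generalize (exp_pos K); lra|]; intros k Hk _; right.
  assert (Hb := HkK k Hk); apply Rabs_le_between in Hb.
  assert (exp (- kappa k) <= exp K).
  { destruct (Req_dec (- kappa k) K) as [->|]; [lra|left; apply exp_increasing; lra]. }
  lra.
Qed.

Definition integrand (t : R) : expr := Mul (Ex t) FE.

Lemma ok_integrand t z : regular z -> ok 1 (integrand t) z.
Proof. intros [H1 H2]; split; [exact I|]; apply ok_transform; assumption. Qed.

Lemma ev_integrand t z : regular z -> ev 1 (integrand t) z = (Cexp (RtoC t * z) * F z)%C.
Proof. intros [H1 H2]; unfold F; rewrite T_ab_ev by assumption; reflexivity. Qed.

Definition vert (t x y1 y2 : R) : C := CI (fun y => ev 1 (integrand t) (x, y)) y1 y2.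
Definition horiz (t y x1 x2 : R) : C := CI (fun x => ev 1 (integrand t) (x, y)) x1 x2.

Lemma contC_vert e x y : 0 < x -> ok 1 e (x, y) -> contC (fun y => ev 1 e (x, y)) y.
Proof.
  intros Hx Hok; apply (contC_ev 1 e (fun y => (x, y)) y); [|exact Hx|exact Hok].
  exact (derC_continuous _ _ _ (derC_vertical x y)).
Qed.

Lemma contC_horiz e x y : 0 < x -> ok 1 e (x, y) -> contC (fun x => ev 1 e (x, y)) x.
Proof.
  intros Hx Hok; apply (contC_ev 1 e (fun x => (x, y)) x); [|exact Hx|exact Hok].
  exact (derC_continuous _ _ _ (derC_horizontal x y)).
Qed.

Lemma ex_CI_vert t x y1 y2 : (forall y, regular (x, y)) -> ex_CI (fun y => ev 1 (integrand t) (x, y)) y1 y2.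
Proof.
  intros Hr; apply ex_CI_cont; intros y _; apply contC_vert; [exact (proj1 (Hr y))|apply ok_integrand, Hr].
Qed.

Lemma vert_split t x L : (forall y, regular (x, y)) ->
  vert t x (- L) L = (vert t x (- L) (-1) + vert t x (-1) 1 + vert t x 1 L)%C.
Proof.
  intros Hr; unfold vert.
  rewrite (CI_Chasles _ (- L) 1 L), (CI_Chasles _ (- L) (-1) 1); try apply ex_CI_vert, Hr.
  reflexivity.
Qed.

Lemma exp_K_lt Lam : Lam0 <= Lam -> exp K < exp Lam.
Proof. intros; apply exp_increasing; lra. Qed.

(** All poles are real, so a rectangle on one side of the real axis contains none. *)
Lemma rectangle_off_axis t x1 x2 y1 y2 : 0 < x1 -> x1 <= x2 -> y1 <= y2 -> 0 < y1 \/ y2 < 0 ->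
  (vert t x2 y1 y2 - vert t x1 y1 y2 = - Ci * (horiz t y2 x1 x2 - horiz t y1 x1 x2))%C.
Proof.
  intros H1 H12 Hy Hs.
  apply (Cauchy_rectangle 1 (integrand t) (fun u v => 0 < u /\ v <> 0) x1 x2 y1 y2 (x1 / 2) (x2 + 1));
    try lra.
  - intros u v [Hu Hv]; apply locally_2d_and; [apply locally_2d_fst_gt | apply locally_2d_snd_neq_0]; assumption.
  - intros u v [Hu Hv]; split; [exact Hu|apply ok_integrand, regular_off_axis; assumption].
  - intros u v Hu Hv; split; lra.
Qed.

(** Every pole is at most exp K < exp Lam0, so this rectangle may cross the real axis. *)
Lemma rectangle_right t Lam L : Lam0 <= Lam -> 0 <= L ->
  (vert t (exp Lam) (- L) L - vert t (exp Lam0) (- L) L =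
   - Ci * (horiz t L (exp Lam0) (exp Lam) - horiz t (- L)%R (exp Lam0) (exp Lam)))%C.
Proof.
  intros HL H0; assert (H1 := exp_K_lt Lam0 (Rle_refl _)).
  assert (exp Lam0 <= exp Lam).
  { destruct (Req_dec Lam0 Lam) as [->|]; [lra|left; apply exp_increasing; lra]. }
  apply (Cauchy_rectangle 1 (integrand t) (fun u v => exp K < u) (exp Lam0) (exp Lam) (- L) L (exp K) (exp Lam + 1));
    try lra.
  - intros u v Hu; apply locally_2d_fst_gt, Hu.
  - intros u v Hu; split; [generalize (exp_pos K); lra|apply ok_integrand, regular_right, Hu].
  - intros u v Hu _; lra.
Qed.

(* The contribution of the notch of the contour around the poles, an entire function of t. *)
Definition notch (t : R) : C :=
  (vert t delta (-1) 1 - vert t (exp Lam0) (-1) 1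
   - Ci * (horiz t 1 delta (exp Lam0) - horiz t (-1) delta (exp Lam0)))%C.

(** Three rectangles are combined: above height 1 and below height -1 between delta and exp Lam0,
    and the full strip to the right of exp Lam0. What is left over depends on neither Lam nor L. *)
Lemma contour_deformation t Lam L : Lam0 <= Lam -> 1 <= L ->
  vert t delta (- L) L = (vert t (exp Lam) (- L) L + notch t
    + Ci * (horiz t L delta (exp Lam0) - horiz t (- L)%R delta (exp Lam0))
    + Ci * (horiz t L (exp Lam0) (exp Lam) - horiz t (- L)%R (exp Lam0) (exp Lam)))%C.
Proof.
  intros HLam HL.
  assert (E1 := rectangle_off_axis t delta (exp Lam0) 1 L Hdelta ltac:(lra) HL ltac:(lra)).
  assert (E2 := rectangle_off_axis t delta (exp Lam0) (- L) (-1) Hdelta ltac:(lra) ltac:(lra) ltac:(lra)).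
  assert (E3 := rectangle_right t Lam L HLam ltac:(lra)).
  assert (S1 := vert_split t delta L regular_delta).
  assert (S2 := vert_split t (exp Lam0) L (fun y => regular_right _ y (exp_K_lt Lam0 (Rle_refl _)))).
  unfold notch.
  set (A := vert t delta (- L) L) in *; set (B := vert t (exp Lam) (- L) L) in *.
  set (A0 := vert t (exp Lam0) (- L) L) in *.
  set (h1 := horiz t L delta (exp Lam0)) in *; set (h2 := horiz t (- L) delta (exp Lam0)) in *.
  set (h3 := horiz t L (exp Lam0) (exp Lam)) in *; set (h4 := horiz t (- L) (exp Lam0) (exp Lam)) in *.
  set (h5 := horiz t 1 delta (exp Lam0)) in *; set (h6 := horiz t (-1) delta (exp Lam0)) in *.
  set (a1 := vert t delta (- L) (-1)) in *; set (a2 := vert t delta (-1) 1) in *; set (a3 := vert t delta 1 L) in *.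
  set (b1 := vert t (exp Lam0) (- L) (-1)) in *; set (b2 := vert t (exp Lam0) (-1) 1) in *;
    set (b3 := vert t (exp Lam0) 1 L) in *.
  assert (F1 : b3 = (a3 - Ci * (h1 - h5))%C)
    by (transitivity (b3 - a3 + a3)%C; [ring|rewrite E1; ring]).
  assert (F2 : b1 = (a1 - Ci * (h6 - h2))%C)
    by (transitivity (b1 - a1 + a1)%C; [ring|rewrite E2; ring]).
  assert (F3 : B = (A0 - Ci * (h3 - h4))%C)
    by (transitivity (B - A0 + A0)%C; [ring|rewrite E3; ring]).
  rewrite F3, S2, S1, F1, F2; ring.
Qed.

(** The four sides are compact and avoid the poles: the left one by the choice of delta, the right
    one by that of Lam0, the horizontal ones by being off the axis. *)
Lemma tower_notch : tower notch.
Proof.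
  assert (V : forall x, (forall y, regular (x, y)) -> tower (fun t => vert t x (-1) 1)).
  { intros x Hx.
    apply (tower_CI_exp (fun y => (x, y)) (fun y => ev 1 FE (x, y)) (-1) 1); intros y _.
    - exact (derC_continuous _ _ _ (derC_vertical x y)).
    - apply contC_vert; [exact (proj1 (Hx y))|exact (proj2 (ok_integrand 0 _ (Hx y)))]. }
  assert (W : forall y, y <> 0 -> tower (fun t => horiz t y delta (exp Lam0))).
  { intros y Hy.
    apply (tower_CI_exp (fun x => (x, y)) (fun x => ev 1 FE (x, y)) delta (exp Lam0)).
    - intros x _; exact (derC_continuous _ _ _ (derC_horizontal x y)).
    - rewrite Rmin_left by lra; intros x Hx; assert (Hr := regular_off_axis x y ltac:(lra) Hy).
      apply contC_horiz; [lra|exact (proj2 (ok_integrand 0 _ Hr))]. }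
  destruct (tower_plus _ _ (tower_plus _ _ (V delta regular_delta)
      (tower_mult (RtoC (-1)) _ (V (exp Lam0) (fun y => regular_right _ y (exp_K_lt Lam0 (Rle_refl _))))))
    (tower_plus _ _ (tower_mult (- Ci)%C _ (W 1 ltac:(lra))) (tower_mult Ci _ (W (-1) ltac:(lra)))))
    as (U & U0 & HU).
  exists U; split; [|exact HU]; intros t; rewrite U0; unfold notch; rewrite RtoC_m1; ring.
Qed.

Lemma F_small eta : 0 < eta -> exists Y, 1 <= Y /\ forall z, 0 < fst z -> Y <= Rabs (snd z) -> Cmod (F z) <= eta.
Proof.
  intros Heta; destruct (T_ab_small p q kappa nu alpha beta eta Hqp Hnu Hnontriv Heta) as [Y HY].
  exists (Rmax 1 Y); split; [apply Rmax_l|]; intros z Hp Hz; apply HY; [exact Hp|].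
  eapply Rle_trans; [apply (Rmax_r 1 Y)|]; eapply Rle_trans; [exact Hz|apply snd_le_Cmod].
Qed.

(** The side has fixed length and the exponential is at most exp (t x2) on it, so the decay of the
    transform suffices. The sign [s] treats the upper and lower side together. *)
Lemma vanishing_horiz t x1 x2 s : 0 < t -> 0 < x1 -> x1 <= x2 -> Rabs s = 1 ->
  vanishing (fun L => horiz t (s * L) x1 x2).
Proof.
  intros Ht H1 H12 Hs eta Heta.
  set (B := 2 * ((x2 - x1) * exp (t * x2))).
  assert (HB : 0 <= B) by (unfold B; generalize (exp_pos (t * x2)); intros; apply Rmult_le_pos; [lra|apply Rmult_le_pos; lra]).
  destruct (F_small (eta / (B + 1))) as (Y & HY1 & HY); [apply Rdiv_lt_0_compat; lra|].
  exists Y; intros L HL.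
  assert (HsL : Rabs (s * L) = L) by (rewrite Rabs_mult, Hs, Rabs_right; lra).
  assert (Hy0 : s * L <> 0) by (intros E; rewrite E, Rabs_R0 in HsL; lra).
  apply Rle_trans with (2 * ((x2 - x1) * (exp (t * x2) * (eta / (B + 1))))).
  - apply Cmod_CI_le; [exact H12| |].
    + apply ex_CI_cont; rewrite Rmin_left by exact H12; intros x Hx.
      apply contC_horiz; [lra|apply ok_integrand, regular_off_axis; [lra|exact Hy0]].
    + intros x Hx; rewrite ev_integrand by (apply regular_off_axis; [lra|exact Hy0]).
      rewrite Cmod_mult, Cmod_Cexp; apply Rmult_le_compat; try apply Cmod_ge_0.
      * left; apply exp_pos.
      * replace (fst (RtoC t * (x, (s * L)%R))%C) with (t * x) by (simpl; ring).
        assert (Hle : t * x <= t * x2) by nra.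
        destruct Hle as [Hle|Hle]; [left; apply exp_increasing, Hle|rewrite Hle; lra].
      * apply HY; simpl; lra.
  - replace (2 * ((x2 - x1) * (exp (t * x2) * (eta / (B + 1))))) with (B * (eta / (B + 1)))
      by (unfold B; ring).
    apply Rmult_le_reg_r with (B + 1); [lra|].
    replace (B * (eta / (B + 1)) * (B + 1)) with (B * eta) by (field; lra); nra.
Qed.

Lemma limC_horiz_difference t x1 x2 : 0 < t -> 0 < x1 -> x1 <= x2 ->
  limC (fun L => Ci * (horiz t L x1 x2 - horiz t (- L)%R x1 x2))%C 0%C.
Proof.
  intros Ht H1 H12.
  assert (V1 := limC_vanishing _ (vanishing_horiz t x1 x2 1 Ht H1 H12 Rabs_R1)).
  assert (V2 := limC_vanishing _ (vanishing_horiz t x1 x2 (-1) Ht H1 H12 ltac:(rewrite Rabs_left; lra))).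
  eapply limC_ext; [| |exact (limC_mult Ci _ _ (limC_plus _ _ _ _ V1 (limC_mult (RtoC (-1)) _ _ V2)))].
  - intros L _; cbv beta; rewrite Rmult_1_l.
    replace (-1 * L) with (- L) by ring; rewrite RtoC_m1; ring.
  - ring.
Qed.

(** * Rescaling *)

Definition prefactor (Lam : R) : R := exp (- nb * Lam) * (/ Lam) ^ a.

(** The condition 1 + 2 K <= Lam0 is made for these bounds: they are the hypotheses of the uniform
    estimates with eps0 = 1 / Lam0. *)
Lemma inv_Lam_bounds Lam : Lam0 <= Lam -> 0 <= / Lam <= / Lam0 /\ / Lam0 <= 1 /\ / Lam0 * K <= / 2.
Proof.
  intros HL; assert (0 < Lam0) by lra; repeat split.
  - left; apply Rinv_0_lt_compat; lra.
  - apply Rinv_le_contravar; lra.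
  - rewrite <- Rinv_1; apply Rinv_le_contravar; lra.
  - apply Rmult_le_reg_l with (2 * Lam0); [lra|].
    replace (2 * Lam0 * (/ Lam0 * K)) with (2 * K) by (field; lra).
    replace (2 * Lam0 * / 2) with Lam0 by field; lra.
Qed.

Lemma F_rescaled Lam y : Lam0 <= Lam ->
  F (exp Lam, exp Lam * y) = (RtoC (prefactor Lam) * ev (/ Lam) (Mul (Pow nb) Lf) (1, y)%R)%C.
Proof.
  intros HL; destruct (inv_Lam_bounds Lam HL) as (B1 & B2 & B3).
  replace (exp Lam, exp Lam * y) with (RtoC (exp Lam) * (1, y)%R)%C by (apply C_ext; simpl; ring).
  apply T_ab_scaled; [lra|simpl; lra|].
  intros k Hk E; destruct (Cmod_line y) as [L1 _].
  generalize (den_ge_half K (/ Lam0) HK B3 (/ Lam) (kappa k) (1, y) B1 (HkK k Hk) ltac:(simpl; lra) L1).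
  rewrite E, Cmod_0; lra.
Qed.

Lemma symbol_Lf : symbol K Lf.
Proof. apply symbol_log_factor, HkK. Qed.

Lemma nb_ge_0 : 0 <= nb.
Proof.
  apply (rsum_from_ge (fun k => INR (beta k) * nu k) (S q) (p - q)).
  intros k Hk; apply Rmult_le_pos; [apply pos_INR|left; apply Hnu; lia].
Qed.

Lemma prefactor_pos Lam : Lam0 <= Lam -> 0 < prefactor Lam.
Proof.
  intros HL; apply Rmult_lt_0_compat; [apply exp_pos|apply pow_lt, Rinv_0_lt_compat; lra].
Qed.

(** Obtained from the decay of the unscaled transform, not from symbol bounds, because [nb] may be
    0. It supplies the first boundary terms of the integration by parts. *)
Lemma vanishing_rescaled Lam s : Lam0 <= Lam -> Rabs s = 1 ->
  vanishing (fun L => ev (/ Lam) (Mul (Pow nb) Lf) (1, s * L)).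
Proof.
  intros HL Hs eta Heta.
  assert (Hc := prefactor_pos Lam HL); assert (He := exp_pos Lam).
  destruct (F_small (prefactor Lam * eta)) as (Y & HY1 & HY); [apply Rmult_lt_0_compat; assumption|].
  exists (Y / exp Lam); intros L HLY.
  assert (HYL : Y <= exp Lam * L).
  { apply (Rmult_le_compat_l (exp Lam)) in HLY; [|lra].
    replace (exp Lam * (Y / exp Lam)) with Y in HLY by (field; lra); exact HLY. }
  assert (HL0 : 0 <= L) by (apply Rmult_le_reg_l with (exp Lam); lra).
  specialize (HY (exp Lam, exp Lam * (s * L)) He).
  rewrite F_rescaled, Cmod_mult, Cmod_R, (Rabs_right (prefactor Lam)) in HY by lra.
  apply Rmult_le_reg_l with (prefactor Lam); [exact Hc|]; apply HY; simpl.
  rewrite !Rabs_mult, Hs, (Rabs_right L), (Rabs_right (exp Lam)); lra.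
Qed.

Lemma vert_rescaled t Lam L : Lam0 <= Lam ->
  vert t (exp Lam) (- L) L =
  (RtoC (exp Lam * prefactor Lam) *
   line_integral (t * exp Lam) (/ Lam) (Mul (Pow nb) Lf) (exp (- Lam) * L))%C.
Proof.
  intros HL; destruct (inv_Lam_bounds Lam HL) as (B1 & B2 & B3).
  assert (Hreg : forall y, regular (exp Lam, y)) by (intros; apply regular_right, exp_K_lt, HL).
  assert (Hee : exp Lam * exp (- Lam) = 1) by (rewrite <- exp_plus, Rplus_opp_r; apply exp_0).
  unfold vert, line_integral.
  replace (- L) with (exp Lam * - (exp (- Lam) * L))
    by (rewrite <- Ropp_mult_distr_r, <- Rmult_assoc, Hee; ring).
  replace L with (exp Lam * (exp (- Lam) * L)) at 2 by (rewrite <- Rmult_assoc, Hee; ring).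
  rewrite (CI_scale (fun y => ev 1 (integrand t) (exp Lam, y)))
    by (intros y; apply contC_vert; [apply exp_pos|apply ok_integrand, Hreg]).
  rewrite RtoC_mult, <- Cmult_assoc; f_equal.
  rewrite <- CI_mult.
  - apply CI_ext; intros y _; rewrite ev_integrand, F_rescaled by (assumption || apply Hreg).
    replace (RtoC t * (exp Lam, exp Lam * y)%R)%C with (RtoC (t * exp Lam) * (1, y)%R)%C
      by (apply C_ext; simpl; ring).
    simpl; ring.
  - apply ex_CI_cont; intros y _; apply contC_line; destruct (Cmod_line y); repeat split.
    apply (ok_symbol K (/ Lam0)); try assumption; try (simpl; lra); apply symbol_Lf.
Qed.

(** * The inverse transform and its asymptotics *)

Definition top_symbol : expr := step3 nb Lf.

Lemma limC_vert t Lam l : 0 < t -> Lam0 <= Lam ->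
  limC (line_integral (t * exp Lam) (/ Lam) (Mul (Pow (nb + 1 + 1 + 1)) top_symbol)) l ->
  limC (fun L => vert t delta (- L) L)
    (notch t + RtoC (exp Lam * prefactor Lam) *
      (- / RtoC (t * exp Lam) * (- / RtoC (t * exp Lam) * (- / RtoC (t * exp Lam) * l))))%C.
Proof.
  intros Ht HL Hl; destruct (inv_Lam_bounds Lam HL) as (B1 & B2 & B3).
  assert (Hth : 0 < t * exp Lam) by (apply Rmult_lt_0_compat; [exact Ht|apply exp_pos]).
  assert (Hinc : exp Lam0 <= exp Lam).
  { destruct (Req_dec Lam0 Lam) as [->|]; [lra|left; apply exp_increasing; lra]. }
  assert (V1 : vanishing (fun L => ev (/ Lam) (Mul (Pow nb) Lf) (1, L))).
  { intros eta Heta; destruct (vanishing_rescaled Lam 1 HL Rabs_R1 eta Heta) as [Y HY].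
    exists Y; intros L HLY; rewrite <- (Rmult_1_l L); apply HY, HLY. }
  assert (V2 : vanishing (fun L => ev (/ Lam) (Mul (Pow nb) Lf) (1, - L))).
  { intros eta Heta.
    destruct (vanishing_rescaled Lam (-1) HL ltac:(rewrite Rabs_left; lra) eta Heta) as [Y HY].
    exists Y; intros L HLY; replace (- L) with (-1 * L) by ring; apply HY, HLY. }
  assert (P := line_integral_by_parts3 K (/ Lam0) (/ Lam) (t * exp Lam) nb Lf l
    HK B2 B3 B1 Hth nb_ge_0 symbol_Lf V1 V2 Hl).
  apply (limC_scale (exp (- Lam)) _ _ (exp_pos _)) in P.
  apply (limC_mult (RtoC (exp Lam * prefactor Lam))) in P.
  assert (Q1 := limC_horiz_difference t delta (exp Lam0) Ht Hdelta ltac:(lra)).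
  assert (Q2 := limC_horiz_difference t (exp Lam0) (exp Lam) Ht (exp_pos _) Hinc).
  assert (S := limC_plus _ _ _ _ (limC_plus _ _ _ _ (limC_plus _ _ _ _ P (limC_const (notch t))) Q1) Q2).
  eapply limC_ext; [| |exact S].
  - intros L HL1; cbv beta.
    rewrite (contour_deformation t Lam L HL HL1), (vert_rescaled t Lam L HL); reflexivity.
  - ring.
Qed.

(** Defined on the original line, so the values computed with different Lam agree. *)
Definition inverse_transform (t : R) : C :=
  limit_value (fun L => CI (bromwich_integrand F delta t) (- L) L).

Lemma inverse_transform_cv t Lam l : 0 < t -> Lam0 <= Lam ->
  limC (line_integral (t * exp Lam) (/ Lam) (Mul (Pow (nb + 1 + 1 + 1)) top_symbol)) l ->
  limC (fun L => CI (bromwich_integrand F delta t) (- L) L) (inverse_transform t) /\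
  inverse_transform t = (RtoC (/ (2 * PI)) * (notch t + RtoC (exp Lam * prefactor Lam) *
      (- / RtoC (t * exp Lam) * (- / RtoC (t * exp Lam) * (- / RtoC (t * exp Lam) * l)))))%C.
Proof.
  intros Ht HL Hl.
  assert (P := limC_mult (RtoC (/ (2 * PI))) _ _ (limC_vert t Lam l Ht HL Hl)).
  apply (limC_ext _ (fun L => CI (bromwich_integrand F delta t) (- L) L) _ _) with (2 := eq_refl) in P.
  - assert (E := limit_value_eq _ _ P); fold (inverse_transform t) in E.
    rewrite E; split; [exact P|reflexivity].
  - intros L _; unfold vert; rewrite <- CI_mult by (apply ex_CI_vert, regular_delta).
    apply CI_ext; intros y _; unfold bromwich_integrand.
    rewrite ev_integrand by apply regular_delta; reflexivity.
Qed.

Lemma top_symbol_cv th Lam : Lam0 <= Lam ->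
  exists l, limC (line_integral th (/ Lam) (Mul (Pow (nb + 1 + 1 + 1)) top_symbol)) l.
Proof.
  intros HL; destruct (inv_Lam_bounds Lam HL) as (B1 & B2 & B3).
  destruct (line_integral_cv K (/ Lam0) HK B2 B3 th (nb + 1 + 1 + 1) top_symbol
    (symbol_step3 K nb Lf symbol_Lf)) as [M HM]; [generalize nb_ge_0; lra|].
  destruct (HM (/ Lam) B1) as (l & Hl & _); exists l; exact Hl.
Qed.

Lemma inverse_transform_correct t : 0 < t -> is_inv_laplace F delta t (inverse_transform t).
Proof.
  (* The fixed Lam0 serves every t > 0, whereas Lam = - ln t is admissible only for small t. *)
  intros Ht; destruct (top_symbol_cv (t * exp Lam0) Lam0 (Rle_refl _)) as [l Hl].
  exact (proj1 (inverse_transform_cv t Lam0 l Ht (Rle_refl _) Hl)).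
Qed.

(** For Lam = - ln t the exponential becomes exp s, and the minus sign is the cube of - 1 from the
    three integrations by parts. *)
Lemma inverse_transform_small_t t : 0 < t < exp (- Lam0) ->
  inverse_transform t = (RtoC (/ (2 * PI)) * notch t
    - RtoC (/ (2 * PI) * (Rpower t (-1 + nb) * (- / ln t) ^ a)) * J (nb + 1 + 1 + 1) top_symbol (- / ln t))%C.
Proof.
  intros [Ht Ht1].
  assert (HL : Lam0 <= - ln t).
  { apply ln_increasing in Ht1; [|exact Ht]; rewrite ln_exp in Ht1; lra. }
  assert (Hexp : exp (- ln t) = / t) by (rewrite exp_Ropp, exp_ln by exact Ht; reflexivity).
  assert (Hth : t * exp (- ln t) = 1) by (rewrite Hexp; field; lra).
  destruct (top_symbol_cv 1 (- ln t) HL) as [l Hl].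
  assert (EJ : J (nb + 1 + 1 + 1) top_symbol (- / ln t) = l).
  { rewrite <- Rinv_opp; exact (limit_value_eq _ _ Hl). }
  rewrite <- Hth in Hl at 1.
  rewrite (proj2 (inverse_transform_cv t (- ln t) l Ht HL Hl)), Hth, EJ.
  replace (Rpower t (-1 + nb) * (- / ln t) ^ a) with (exp (- ln t) * prefactor (- ln t)).
  - rewrite (RtoC_mult (/ (2 * PI))); field; exact RtoC_1_neq_0.
  - unfold prefactor, Rpower; rewrite Rinv_opp, <- Rmult_assoc, <- exp_plus; do 2 f_equal; ring.
Qed.

(* The sign converts powers of eps = - 1 / ln t into powers of 1 / ln t. *)
Definition coefficient (k : nat) : C :=
  (RtoC (- / (2 * PI) * (-1) ^ (a + k)) * J (nb + 1 + 1 + 1) (restn k top_symbol) 0)%C.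

Lemma inverse_transform_asymptotics :
  has_log_asymptotics (fun t => inverse_transform t - RtoC (/ (2 * PI)) * notch t)%C coefficient nb a.
Proof.
  intros N; destruct (inv_Lam_bounds Lam0 (Rle_refl _)) as (B1 & B2 & B3).
  assert (B4 : 0 <= / Lam0 <= 1) by lra.
  assert (Hv : 3 <= nb + 1 + 1 + 1) by (generalize nb_ge_0; lra).
  assert (Hs : symbol K top_symbol) by exact (symbol_step3 K nb Lf symbol_Lf).
  (* [M] bounds the remainder integral for all eps in [0, 1 / Lam0], that is for all t < exp (-
     Lam0); hence one constant for the order N. *)
  destruct (J_spec K (/ Lam0) (nb + 1 + 1 + 1) HK B4 B3 Hv (restn N top_symbol)
    (symbol_restn K N _ Hs)) as [M HM].
  exists (/ (2 * PI) * M), (exp (- Lam0)); split; [apply exp_pos|]; intros t Ht.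
  rewrite (inverse_transform_small_t t Ht).
  destruct Ht as [Ht Ht1].
  assert (HL : Lam0 <= - ln t).
  { apply ln_increasing in Ht1; [|exact Ht]; rewrite ln_exp in Ht1; lra. }
  assert (He : 0 <= - / ln t <= / Lam0).
  { rewrite <- Rinv_opp; apply (inv_Lam_bounds (- ln t) HL). }
  set (eps := - / ln t) in *; set (P := Rpower t (-1 + nb)).
  assert (Hasym : forall k, asym_term nb a k t = P * eps ^ (a + k) * (-1) ^ (a + k)).
  { intros k; unfold asym_term; fold P; rewrite Rmult_assoc, <- Rpow_mult_distr; do 2 f_equal.
    unfold eps; ring. }
  assert (Hsum : forall n, Csum_lt (fun k => coefficient k * RtoC (asym_term nb a k t))%C n =
    (RtoC (- / (2 * PI) * (P * eps ^ a)) *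
     Csum_lt (fun k => RtoC (eps ^ k) * J (nb + 1 + 1 + 1) (restn k top_symbol) 0)%C n)%C).
  { induction n as [|n IH]; simpl; [ring|]; rewrite IH, Cmult_plus_distr_l; f_equal.
    unfold coefficient; rewrite Hasym.
    (* The sign in the coefficient meets the equal sign from rewriting 1 / ln t as - eps, and their
       product is 1. *)
    transitivity (RtoC (- / (2 * PI) * (P * eps ^ (a + n)) * ((-1) ^ (a + n) * (-1) ^ (a + n))) *
      J (nb + 1 + 1 + 1) (restn n top_symbol) 0)%C.
    - rewrite !RtoC_mult; ring.
    - rewrite <- Rpow_mult_distr; replace (-1 * -1) with 1 by ring.
      rewrite pow1, Rmult_1_r, pow_add, !RtoC_mult; ring. }
  rewrite Hsum, (J_expansion K (/ Lam0) (nb + 1 + 1 + 1) HK B4 B3 Hv N top_symbol eps Hs He).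
  match goal with |- Cmod ?z <= _ =>
    replace z with (RtoC (- / (2 * PI) * (P * eps ^ (a + N))) *
      J (nb + 1 + 1 + 1) (restn N top_symbol) eps)%C end.
  2: { rewrite pow_add, !RtoC_mult, RtoC_opp; ring. }
  rewrite Cmod_mult, Cmod_R, Hasym.
  assert (HP : 0 < P) by apply exp_pos; assert (HPI := PI_RGT_0).
  assert (HE : 0 <= P * eps ^ (a + N)) by (apply Rmult_le_pos; [lra|apply pow_le; lra]).
  assert (Hi : 0 < / (2 * PI)) by (apply Rinv_0_lt_compat; lra).
  rewrite !(Rabs_mult _ (P * _)), Rabs_Ropp, (Rabs_right (/ (2 * PI))) by lra.
  rewrite (Rabs_mult (P * _)), pow_1_abs, Rmult_1_r, (Rabs_right (P * _)) by lra.
  replace (/ (2 * PI) * M * (P * eps ^ (a + N))) with (/ (2 * PI) * (P * eps ^ (a + N)) * M) by ring.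
  apply Rmult_le_compat_l; [apply Rmult_le_pos; lra|apply HM, He].
Qed.

End Transform.

Theorem theorem8p2
  (p q : nat) (kappa nu : nat -> R) (alpha beta : nat -> nat) (delta : R)
  (Hqp : (q <= p)%nat)
  (Hnu : forall k, (S q <= k <= p)%nat -> 0 < nu k < 1)
  (Hdelta : 0 < delta)
  (Hpole : forall k, (1 <= k <= q)%nat -> (0 < alpha k)%nat -> delta <> exp (- kappa k))
  (Hnontriv : (exists k, (1 <= k <= q)%nat /\ (0 < alpha k)%nat) \/
              (exists k, (S q <= k <= p)%nat /\ (0 < beta k)%nat)) :
  exists f : R -> C,
    (forall t, 0 < t -> is_inv_laplace (T_ab p q kappa nu alpha beta) delta t (f t)) /\
    exists (g : R -> C) (E : nat -> C),
      smooth_on_closed_halfline g /\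
      has_log_asymptotics (fun t => Cminus (f t) (g t)) E
        (nu_beta p q nu beta) (abs_alpha q alpha).
Proof.
  destruct (kappa_bound kappa q) as (K & HK & HkK).
  (* The summand delta gives delta < exp Lam0 through exp x >= 1 + x. *)
  set (Lam0 := 1 + 2 * K + delta).
  assert (HL1 : 1 + 2 * K <= Lam0) by (unfold Lam0; lra).
  assert (HLd : delta < exp Lam0).
  { generalize (exp_ineq1_le Lam0); unfold Lam0; lra. }
  exists (inverse_transform p q kappa nu alpha beta delta); split.
  - intros t Ht; apply (inverse_transform_correct p q kappa nu alpha beta delta K Lam0); assumption.
  - exists (fun t => RtoC (/ (2 * PI)) * notch p q kappa nu alpha beta delta Lam0 t)%C.
    exists (coefficient p q kappa nu alpha beta); split.
    + apply tower_smooth, tower_mult.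
      apply (tower_notch p q kappa nu alpha beta delta K Lam0); assumption.
    + apply (inverse_transform_asymptotics p q kappa nu alpha beta delta K Lam0); assumption.
Qed.
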